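(* Suppose that the initial empirical vector $\mu^{N}(0)=(\mu_1^{c,N}(0),\mu_1^{p,N}(0),\ldots,\mu_r^{c,N}(0),\mu_r^{p,N}(0))$ converges weakly, as $N\to\infty$, to $\nu=(\nu_1^c,\nu_1^p,\ldots,\nu_r^c,\nu_r^p)\in(\mathcal{M}_1(\mathcal{Z}))^{2r}$. Then the empirical vector process $\mu^N(t)$ converges in probability, uniformly over compact time intervals, to the solution $\mu(t)=(\mu_1^c(t),\mu_1^p(t),\ldots,\mu_r^c(t),\mu_r^p(t))$ of the McKean-Vlasov system $$\dot\mu_j^c(t)=\mu_j^c(t)A^{j,c}_{\mu(t)},\qquad \dot\mu_j^p(t)=\mu_j^p(t)A^{j,p}_{\mu(t)},\qquad \mu_j^c(0)=\nu_j^c,\quad \mu_j^p(0)=\nu_j^p,\qquad 1\le j\le r .$$ That is, for every $T>0$ and $\varepsilon>0$, $\mathbb{P}\big(\sup_{0\le t\le T}\|\mu^N(t)-\mu(t)\|>\varepsilon\big)\to0$ as $N\to\infty$.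
   Context: **Graph.** $\mathcal{Z}=\{1,\ldots,K\}$ is a finite set and $\mathcal{M}_1(\mathcal{Z})$ is the set of probability measures on $\mathcal{Z}$, viewed as row vectors in $\mathbb{R}^K$. For each $N$, a set of $N$ nodes is partitioned into $r$ blocks $C_1,\ldots,C_r$ with $|C_j|=N_j$, and each block is partitioned as $C_j=C_j^c\cup C_j^p$ (central and peripheral nodes) with $|C_j^c|=N_j^c$, $|C_j^p|=N_j^p$. Put $C^p=\bigcup_{j=1}^r C_j^p$. Standing assumption: there are $\alpha_j,p_j^c,p_j^p\in(0,1)$ with $p_j^c+p_j^p=1$ and $\sum_j\alpha_j=1$ such that, as $N\to\infty$, $N_j/N\to\alpha_j$, $N_j^c/N_j\to p_j^c$, $N_j^p/N_j\to p_j^p$ for $1\le j\le r$. **Energy.** $W:\mathcal{Z}\times\mathcal{Z}\to\mathbb{R}$ is symmetric, $\beta>0$, and for $\boldsymbol{x}\in\mathcal{Z}^N$ (one coordinate per node) $$U_N(\boldsymbol{x})=\frac{\beta}{2N}\sum_{j=1}^r\Big[\sum_{i\in C_j^c}\sum_{k\in C_j}W(x_i,x_k)+\sum_{i\in C_j^p}\sum_{k\in C_j^c\cup C^p}W(x_i,x_k)\Big].$$ **Admissible jumps.** $\mathcal{E}\subset\mathcal{Z}\times\mathcal{Z}\setminus\{(z,z):z\in\mathcal{Z}\}$ is symmetric and the directed graph $(\mathcal{Z},\mathcal{E})$ is irreducible; $a(z,z')=1$ if $(z,z')\in\mathcal{E}$ and $a(z,z')=0$ otherwise. **Particle system.** $(\boldsymbol{x}^N(t))_{t\ge0}$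 is the continuous-time Markov chain on $\mathcal{Z}^N$ with jump rates, for $\boldsymbol{x}\ne\boldsymbol{y}$, $\psi^N(\boldsymbol{x},\boldsymbol{y})=e^{-(U_N(\boldsymbol{y})-U_N(\boldsymbol{x}))^+}A_N(\boldsymbol{x},\boldsymbol{y})$, where $A_N(\boldsymbol{x},\boldsymbol{y})=a(x_l,y_l)$ if $\boldsymbol{x},\boldsymbol{y}$ differ in exactly one index $l$, and $A_N(\boldsymbol{x},\boldsymbol{y})=0$ otherwise. The local empirical measures are $\mu_j^{\iota,N}(t)=\frac1{N_j^\iota}\sum_{i\in C_j^\iota}\delta_{x_i(t)}$ for $1\le j\le r$, $\iota\in\{c,p\}$, and $\mu^N(t)=(\mu_1^{c,N}(t),\mu_1^{p,N}(t),\ldots,\mu_r^{c,N}(t),\mu_r^{p,N}(t))$. The initial condition $\boldsymbol{x}^N(0)$ is multi-exchangeable, i.e. its law is invariant under permutations of the indices within each of the $2r$ classes $C_j^\iota$. **Limiting rates.** For $q=(q^{1,c},q^{1,p},\ldots,q^{r,c},q^{r,p})\in(\mathcal{M}_1(\mathcal{Z}))^{2r}$ let $$\psi^{j,c}(z,z',q)=\beta\sum_{x\in\mathcal{Z}}(W(x,z')-W(x,z))\big(\alpha_jp_j^cq_x^{j,c}+\alpha_jp_j^pq_x^{j,p}\big),$$ $$\psi^{j,p}(z,z',q)=\beta\sum_{x\in\mathcal{Z}}(W(x,z')-W(x,z))\Big(\alpha_jp_j^cq_x^{j,c}+\sum_{l=1}^r\alpha_lp_l^pq_x^{l,p}\Big),$$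 and for $\iota\in\{c,p\}$ let $\lambda^{j,\iota}_{z,z'}(q)=e^{-(\psi^{j,\iota}(z,z',q))^+}a(z,z')$ for $z\ne z'$, $\lambda^{j,\iota}_{z,z}(q)=-\sum_{z'\ne z}\lambda^{j,\iota}_{z,z'}(q)$, and $A^{j,\iota}_q=(\lambda^{j,\iota}_{z,z'}(q))_{z,z'\in\mathcal{Z}}$. Here $u^+=\max(u,0)$. *)

(* Defs.v *)
From HB Require Import structures.
From mathcomp Require Import all_boot all_order all_fingroup all_algebra.
From mathcomp Require Import all_classical all_reals all_analysis.

Set Implicit Arguments.
Unset Strict Implicit.
Unset Printing Implicit Defensive.

Import Order.TTheory GRing.Theory Num.Theory.
Import numFieldNormedType.Exports.
Local Open Scope classical_set_scope.
Local Open Scope ring_scope.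

(** * Block structure

    A partition of the N nodes into r blocks, each split into central and
    peripheral nodes, is given by the block [blk i] of a node [i] and a boolean
    [ctr i] telling whether [i] is central. *)

Definition block (N r : nat) (blk : 'I_N -> 'I_r) (j : 'I_r) : {set 'I_N} :=
  [set i | blk i == j]%SET.

Definition central (N r : nat) (blk : 'I_N -> 'I_r) (ctr : 'I_N -> bool)
    (j : 'I_r) : {set 'I_N} :=
  [set i | (blk i == j) && ctr i]%SET.

Definition peripheral (N r : nat) (blk : 'I_N -> 'I_r) (ctr : 'I_N -> bool)
    (j : 'I_r) : {set 'I_N} :=
  [set i | (blk i == j) && ~~ ctr i]%SET.

Definition all_peripheral (N r : nat) (blk : 'I_N -> 'I_r)
    (ctr : 'I_N -> bool) : {set 'I_N} :=
  \bigcup_(j < r) peripheral blk ctr j.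

(** * Particle system *)

Definition energy (R : realType) (K r : nat) (W : 'I_K -> 'I_K -> R) (beta : R)
    (N : nat) (blk : 'I_N -> 'I_r) (ctr : 'I_N -> bool)
    (x : {ffun 'I_N -> 'I_K}) : R :=
  beta / (2 * N%:R) *
  \sum_(j < r)
    (\sum_(i in central blk ctr j) \sum_(k in block blk j) W (x i) (x k)
     + \sum_(i in peripheral blk ctr j)
         \sum_(k in central blk ctr j :|: all_peripheral blk ctr)
           W (x i) (x k)).

Definition admissible (K : nat) (E : rel 'I_K) (N : nat)
    (x y : {ffun 'I_N -> 'I_K}) : bool :=
  [exists l, ([set i | x i != y i]%SET == [set l]%SET) && E (x l) (y l)].

Definition jump_rate (R : realType) (K r : nat) (W : 'I_K -> 'I_K -> R)
    (beta : R) (E : rel 'I_K) (N : nat) (blk : 'I_N -> 'I_r)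
    (ctr : 'I_N -> bool) (x y : {ffun 'I_N -> 'I_K}) : R :=
  expR (- Num.max (energy W beta blk ctr y - energy W beta blk ctr x) 0)
  * (admissible E x y)%:R.

Definition transition_function (R : realType) (S : finType)
    (p : R -> S -> S -> R) : Prop :=
  [/\ forall t x y, 0 <= t -> 0 <= p t x y,
      forall t x, 0 <= t -> \sum_y p t x y = 1,
      forall x y, p 0 x y = (x == y)%:R &
      forall s t x y, 0 <= s -> 0 <= t ->
        p (s + t) x y = \sum_z p s x z * p t z y].

(** Only the off-diagonal rates are prescribed: as the state space is finite
    and [p] is stochastic, the derivative of [p _ x x] at 0 is then minus the
    total jump rate out of [x]. *)
Definition has_jump_rates (R : realType) (S : finType) (p : R -> S -> S -> R)
    (psi : S -> S -> R) : Prop :=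
  forall x y, x != y -> p h x y / h @[h --> 0^'+] --> psi x y.

(** The process [X] (relevant only at times [t >= 0]) is a continuous-time
    Markov chain on the finite set [S] with jump rates [psi x y] for [x != y].
    Paths are right-continuous for the discrete topology on [S], and the Markov
    property is in unconditioned form, so that it needs no assumption that
    the conditioning event has positive probability. *)
Definition markov_chain (R : realType) (d : measure_display)
    (Omega : measurableType d) (P : probability Omega R) (S : finType)
    (psi : S -> S -> R) (X : R -> Omega -> S) : Prop :=
  [/\ forall t s, 0 <= t -> measurable [set w | X t w = s],
      forall w t, 0 <= t -> \forall u \near t^'+, X u w = X t w &
      exists p : R -> S -> S -> R,
        [/\ transition_function p, has_jump_rates p psi &
          forall (n : nat) (t : nat -> R) (s : nat -> S),
            0 <= t 0%N -> {homo t : i j / (i <= j)%N >-> i <= j} ->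
            P [set w | forall i, (i <= n.+1)%N -> X (t i) w = s i] =
            (P [set w | forall i, (i <= n)%N -> X (t i) w = s i] *
             (p (t n.+1 - t n) (s n) (s n.+1))%:E)%E]].

(** The law of [Y] is invariant under the permutations of the nodes that
    preserve every class of central or peripheral nodes of a block. *)
Definition multi_exchangeable (R : realType) (d : measure_display)
    (Omega : measurableType d) (P : probability Omega R) (K r N : nat)
    (blk : 'I_N -> 'I_r) (ctr : 'I_N -> bool)
    (Y : Omega -> {ffun 'I_N -> 'I_K}) : Prop :=
  forall s : {perm 'I_N},
    (forall i, blk (s i) = blk i /\ ctr (s i) = ctr i) ->
    forall x : {ffun 'I_N -> 'I_K},
      P [set w | [ffun i => Y w (s i)] = x] = P [set w | Y w = x].

(** * Vectors of measures

    A vector [q] of 2r measures on ['I_K] is a pair of matrices: row [j] of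
    [q.1] is the measure attached to the central nodes of block [j], row [j] of
    [q.2] the one attached to its peripheral nodes. The norm on this space is
    the maximum of the absolute values of the entries. *)

Notation measure_vector R r K := ('M[R]_(r, K) * 'M[R]_(r, K))%type.

Definition probability_vectors (R : realType) (r K : nat) :
    set (measure_vector R r K) :=
  [set q : measure_vector R r K | forall j, [/\ forall z, 0 <= q.1 j z, \sum_z q.1 j z = 1,
                         forall z, 0 <= q.2 j z & \sum_z q.2 j z = 1]].

(** Equal to 0 when [A] is empty. *)
Definition empirical_measure (R : realType) (K N : nat) (A : {set 'I_N})
    (x : {ffun 'I_N -> 'I_K}) : 'rV[R]_K :=
  #|A|%:R^-1 *: \sum_(i in A) delta_mx 0 (x i).

Definition empirical_vector (R : realType) (K r N : nat) (blk : 'I_N -> 'I_r)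
    (ctr : 'I_N -> bool) (x : {ffun 'I_N -> 'I_K}) : measure_vector R r K :=
  (\matrix_(j < r) empirical_measure R (central blk ctr j) x,
   \matrix_(j < r) empirical_measure R (peripheral blk ctr j) x).

(** Convergence in law to the constant [v] of random variables that may live on
    different probability spaces. *)
Definition converges_weakly_to (R : realType) (d : nat -> measure_display)
    (Omega : forall N, measurableType (d N))
    (P : forall N, probability (Omega N) R) (V : normedModType R)
    (Y : forall N, Omega N -> V) (v : V) : Prop :=
  forall f : V -> R, continuous f -> [bounded f q | q in setT] ->
    ('E_(P N)[f \o Y N])%E @[N --> \oo] --> (f v)%:E.

(** * McKean-Vlasov system *)

Definition potential_c (R : realType) (K r : nat) (W : 'I_K -> 'I_K -> R)
    (beta : R) (alpha pc pp : 'I_r -> R) (j : 'I_r) (z z' : 'I_K)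
    (q : measure_vector R r K) : R :=
  beta * \sum_x (W x z' - W x z) *
    (alpha j * pc j * q.1 j x + alpha j * pp j * q.2 j x).

Definition potential_p (R : realType) (K r : nat) (W : 'I_K -> 'I_K -> R)
    (beta : R) (alpha pc pp : 'I_r -> R) (j : 'I_r) (z z' : 'I_K)
    (q : measure_vector R r K) : R :=
  beta * \sum_x (W x z' - W x z) *
    (alpha j * pc j * q.1 j x + \sum_(l < r) alpha l * pp l * q.2 l x).

Definition rate_matrix (R : realType) (K : nat) (E : rel 'I_K)
    (psi : 'I_K -> 'I_K -> R) : 'M[R]_K :=
  let lambda z z' := expR (- Num.max (psi z z') 0) * (E z z')%:R in
  \matrix_(z, z') if z == z' then - \sum_(y | y != z) lambda z y
                  else lambda z z'.

Definition generator_c (R : realType) (K r : nat) (W : 'I_K -> 'I_K -> R)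
    (beta : R) (E : rel 'I_K) (alpha pc pp : 'I_r -> R) (j : 'I_r)
    (q : measure_vector R r K) : 'M[R]_K :=
  rate_matrix E (fun z z' => potential_c W beta alpha pc pp j z z' q).

Definition generator_p (R : realType) (K r : nat) (W : 'I_K -> 'I_K -> R)
    (beta : R) (E : rel 'I_K) (alpha pc pp : 'I_r -> R) (j : 'I_r)
    (q : measure_vector R r K) : 'M[R]_K :=
  rate_matrix E (fun z z' => potential_p W beta alpha pc pp j z z' q).

(** Only the restriction of [mu] to times [t >= 0] matters. At time 0 the equation
    (with a one-sided derivative) follows from continuity. *)
Definition mckean_vlasov (R : realType) (K r : nat) (W : 'I_K -> 'I_K -> R)
    (beta : R) (E : rel 'I_K) (alpha pc pp : 'I_r -> R)
    (nu : measure_vector R r K) (mu : R -> measure_vector R r K) : Prop :=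
  [/\ mu 0 = nu,
      forall t, 0 <= t -> probability_vectors (mu t),
      {within `[0, +oo[, continuous mu} &
      forall (t : R) (j : 'I_r), 0 < t ->
        is_derive t (1 : R) (fun s : R => row j (mu s).1)
          (row j (mu t).1 *m generator_c W beta E alpha pc pp j (mu t)) /\
        is_derive t (1 : R) (fun s : R => row j (mu s).2)
          (row j (mu t).2 *m generator_p W beta E alpha pc pp j (mu t))].

(* Main.v *)
Require Import Defs.
From mathcomp Require Import all_boot all_order all_fingroup all_algebra.
From mathcomp Require Import all_classical all_reals all_analysis.
From mathcomp Require Import measurable_realfun ring lra.

Set Implicit Arguments.
Unset Strict Implicit.
Unset Printing Implicit Defensive.

Import Order.TTheory GRing.Theory Num.Theory.
Import numFieldNormedType.Exports.
Local Open Scope classical_set_scope.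
Local Open Scope ring_scope.

(* Nodes fall into 2r classes, the central and the peripheral ones of each block.
   Flipping one node moves the empirical vector q(x) by 1/|class|, and the energy
   difference is the limiting potential at q(x) up to O(1/N) and the error in the
   class frequencies, uniformly in x. Hence V(t, x) = sum_i (q_i(x) - m_i(t))^2,
   with m the solution of the limiting equation, satisfies
   (d/dt + generator) V <= C V + delta with delta -> 0, so that
   exp(-Ct) V(t, X(t)) + delta (T - t) is a nonnegative supermartingale. Its
   maximal inequality bounds P(sup_{t <= T} V > eps^2) by
   (E V(0, X(0)) + delta T) / (eps^2 exp(-CT)), which tends to 0. The maximal
   inequality is only needed along dyadic grids, where it is a finite computation
   with the finite-dimensional laws; right-continuity of the paths extends it to
   all times. The solution m itself is the limit of Euler schemes, which preserve
   the product of simplexes. *)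

(** The squared distance suits the generator: a jump from x to y changes it by a term linear in q(y)
    - q(x), which sums to the drift, and by a square, which sums to O(1/N), as about N nodes flip at
    bounded rate and each flip moves q by O(1/N). The constant C comes from the Lipschitz constant
    of the limiting field and the number 2rK of coordinates, so all dependence on N sits in delta
    and in the initial value. The Metropolis rates contain a positive part, so the limiting field is
    treated as merely Lipschitz, with constants valid on the cube of vectors with entries in [0, 1].
    Hence the estimates ask for arguments in the cube, and existence goes through a scheme with an
    evident invariant set. The solution enters the probabilistic part only through a forward
    quadratic bound on m(t + s) - m(t) - s F(m(t)), which the scheme delivers directly. Over a time
    h the transition function is compared with h times the generator up to eta h. For fixed N the
    configurations are finitely many, so one h serves them all; eta is sent to 0 before N grows. *)

(** * Elementary inequalities *)

Lemma cvg_of_geometric (R : realType) (u : nat -> R) (A : R) :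
  (forall n, `|u n.+1 - u n| <= A / 2 ^+ n) -> cvgn u.
Proof.
move=> uA.
have A0 : 0 <= A by have := le_trans (normr_ge0 _) (uA 0%N); rewrite expr0 divr1.
have /cvg_ex[l ul] : cvgn (series (telescope u)).
  apply: normed_cvg; apply: (series_le_cvg (v_ := geometric A (2^-1))) => [n|n|n|].
  - exact: normr_ge0.
  - by rewrite /= mulr_ge0// exprn_ge0// invr_ge0.
  - by rewrite /= exprVn; exact: uA.
  - by apply: is_cvg_geometric_series; rewrite ger0_norm ?invr_ge0// invf_lt1// ltr1n.
apply/cvg_ex; exists (l + u 0%N).
have u0 : (fun=> u 0%N) @ \oo --> u 0%N by exact: cvg_cst.
suff uE : series (telescope u) + (fun=> u 0%N) = u.
  by rewrite -[X in X @ _]uE; exact: cvgD.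
by apply/funext => n; rewrite fctE /series/telescope/= telescope_sumr// subrK.
Qed.

Lemma cvg_half_pow (R : realType) (a : R) : a / 2 ^+ n @[n --> \oo] --> (0 : R).
Proof.
under eq_fun do rewrite -exprVn.
have : `|2^-1 : R| < 1 by rewrite ger0_norm ?invr_ge0// invf_lt1// ltr1n.
exact: (@cvg_geometric R a).
Qed.

(** Cauchy-Schwarz against the constant vector, obtained from 2xy <= x^2 + y^2 on each product. It
    converts the l1 Lipschitz bound on the field into a bound by the sum of squares, whence the
    factor [#|I|] in the Gronwall constants. *)
Lemma sum_abs_sqr_le (R : realType) (I : finType) (a : I -> R) :
  \sum_i `|a i| * (\sum_j `|a j|) <= #|I|%:R * \sum_i a i ^+ 2.
Proof.
apply: (@le_trans _ _ (\sum_i \sum_j (a i ^+ 2 + a j ^+ 2) / 2)).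
  apply: ler_sum => i _; rewrite big_distrr/=; apply: ler_sum => j _.
  rewrite -(real_normK (num_real (a i))) -(real_normK (num_real (a j))).
  by have := sqr_ge0 (`|a i| - `|a j|); nra.
under eq_bigr do under eq_bigr do rewrite mulrDl.
under eq_bigr do rewrite big_split/=.
rewrite big_split/= [X in _ + X]exchange_big/= -big_split/=.
rewrite big_distrr/=; apply: ler_sum => i _.
by rewrite sumr_const -mulrnDl -splitr mulr_natl.
Qed.

(** Both u -> max(u, 0) and x -> exp(-x) on x >= 0 are 1-Lipschitz. The second fact follows from
    exp(-y) = exp(-x) exp(x - y) and 1 + (x - y) <= exp(x - y). *)
Lemma expR_max_lipschitz (R : realType) (u v : R) :
  `|expR (- Num.max u 0) - expR (- Num.max v 0)| <= `|u - v|.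
Proof.
have key (x y : R) : 0 <= x -> x <= y -> `|expR (- x) - expR (- y)| <= y - x.
  move=> x0 xy; rewrite ger0_norm; last by rewrite subr_ge0 ler_expR lerN2.
  have -> : expR (- y) = expR (- x) * expR (x - y).
    by rewrite -expRD; congr expR; ring.
  have e1 : expR (- x) <= 1 by rewrite -expR0 ler_expR oppr_le0.
  have e2 := expR_ge1Dx (x - y); have e3 := expR_ge0 (- x).
  have e4 : expR (x - y) <= 1 by rewrite -expR0 ler_expR subr_le0.
  nra.
wlog uv : u v / u <= v.
  move=> H; have [/H//|/ltW/H] := leP u v.
  by rewrite distrC (distrC v).
apply: le_trans (key _ _ _ _) _.
- by rewrite le_max lexx orbT.
- by rewrite ge_max !le_max uv lexx orbT.
- rewrite (ler0_norm (x := u - v)) ?subr_le0// opprB.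
  by case: (leP u 0) => ?; case: (leP v 0) => ?; lra.
Qed.

Lemma expR_max_itv (R : realType) (u : R) : 0 <= expR (- Num.max u 0) <= 1.
Proof.
by rewrite expR_ge0 -expR0 ler_expR oppr_le0 le_max lexx orbT.
Qed.

Lemma bool_itv01 (R : realType) (b : bool) : 0 <= (b%:R : R) <= 1.
Proof. by case: b; rewrite /= ?lexx ?ler01. Qed.

Lemma term_le_sum (R : realType) (J : finType) (f : J -> R) j :
  (forall i, 0 <= f i) -> f j <= \sum_i f i.
Proof. by move=> f0; rewrite (bigD1 j)//= lerDl sumr_ge0. Qed.

(** * Euler scheme for a Lipschitz field *)

Section EulerScheme.
Variables (R : realType) (I : finType) (F : (I -> R) -> I -> R).
Variables (D : set (I -> R)) (L B h0 : R).
Hypotheses (L_ge0 : 0 <= L) (B_ge0 : 0 <= B) (h0_gt0 : 0 < h0).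
Hypothesis F_lip : forall u v i, D u -> D v ->
  `|F u i - F v i| <= L * \sum_j `|u j - v j|.
Hypothesis F_bnd : forall u i, D u -> `|F u i| <= B.
Hypothesis D_step : forall u h, D u -> 0 <= h <= h0 ->
  D (fun i => u i + h * F u i).
Hypothesis D_closed : forall (u : nat -> I -> R) v, (forall n, D (u n)) ->
  (forall i, u n i @[n --> \oo] --> v i) -> D v.

Let M : R := L * #|I|%:R.
Let M_ge0 : 0 <= M. Proof. by rewrite mulr_ge0. Qed.

Let F_lip_bnd u v i b : D u -> D v -> (forall j, `|u j - v j| <= b) ->
  `|F u i - F v i| <= M * b.
Proof.
move=> Du Dv uvb; apply: le_trans (F_lip i Du Dv) _.
rewrite -mulrA ler_wpM2l// mulr_natl -sumr_const.
by apply: ler_sum => j _; exact: uvb.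
Qed.

(** The field is controlled on [D] only; for steps at most [h0] the scheme never leaves [D], so all
    the bounds stay available along it. *)
Definition euler_step (h : R) (u : I -> R) : I -> R := fun i => u i + h * F u i.
Definition euler (h : R) (u : I -> R) (k : nat) : I -> R :=
  iter k (euler_step h) u.

Lemma eulerS h u k i :
  euler h u k.+1 i = euler h u k i + h * F (euler h u k) i.
Proof. by []. Qed.

Lemma euler_in h u k : 0 <= h <= h0 -> D u -> D (euler h u k).
Proof. by move=> hh Du; elim: k => //= k IH; exact: D_step. Qed.

Lemma euler_lipschitz h u k m i : 0 <= h <= h0 -> D u ->
  `|euler h u (k + m) i - euler h u k i| <= m%:R * h * B.
Proof.
move=> hh Du; have /andP[h_ge0 _] := hh.
elim: m => [|m IH]; first by rewrite addn0 subrr normr0 !mul0r.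
rewrite addnS eulerS addrAC (le_trans (ler_normD _ _))//.
rewrite -natr1 2!mulrDl lerD// mul1r normrM (ger0_norm h_ge0) ler_wpM2l//.
by apply: F_bnd; exact: euler_in.
Qed.

(** Freezing the field at step k costs at most M (j h B) at the j-th later step, since the scheme
    moves at speed at most [B]. The square closes the induction: m^2 + m <= (m + 1)^2. *)
Lemma euler_quadratic h u k m i : 0 <= h <= h0 -> D u ->
  `|euler h u (k + m) i - euler h u k i - m%:R * h * F (euler h u k) i|
    <= (m%:R * h) ^+ 2 * (M * B).
Proof.
move=> hh Du; have /andP[h_ge0 _] := hh.
elim: m => [|m IH]; first by rewrite addn0 subrr !mul0r subr0 normr0 expr0n mul0r.
rewrite addnS eulerS.
set e := euler h u (k + m) in IH *; set f := euler h u k in IH *.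
have -> : e i + h * F e i - f i - m.+1%:R * h * F f i =
  (e i - f i - m%:R * h * F f i) + h * (F e i - F f i).
  by rewrite -natr1; ring.
rewrite (le_trans (ler_normD _ _))// (le_trans (lerD IH (lexx _)))//.
have Fef : `|F e i - F f i| <= M * (m%:R * h * B).
  by apply: F_lip_bnd => [||j]; [exact: euler_in..|exact: euler_lipschitz].
rewrite normrM (ger0_norm h_ge0).
rewrite (le_trans (lerD (lexx _) (ler_wpM2l h_ge0 Fef)))//.
have -> : h * (M * (m%:R * h * B)) = m%:R * h ^+ 2 * (M * B) by ring.
rewrite -mulrDl ler_wpM2r ?mulr_ge0//.
rewrite -natr1 !exprMn -mulrDl ler_wpM2r ?exprn_ge0//.
by have : 0 <= m%:R :> R by []; nra.
Qed.

(** One coarse step and two half steps differ by a local error h^2 M B, from [euler_quadratic] with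
    m = 2; a discrete Gronwall argument propagates it, closing through (1 + M h) exp(M k h) <= exp(M
    (k + 1) h). The global error is of order h, hence summable along halved meshes. *)
Lemma euler_half h u k i : 0 <= h <= h0 -> D u ->
  `|euler (h / 2) u k.*2 i - euler h u k i|
    <= k%:R * h * expR (M * (k%:R * h)) * (M * B * h).
Proof.
move=> hh Du; have /andP[h_ge0 hlt] := hh.
have hh2 : 0 <= h / 2 <= h0 by apply/andP; split; lra.
elim: k i => [|k IH] i; first by rewrite subrr normr0 !mul0r.
have := @euler_quadratic (h / 2) u k.*2 2 i hh2 Du.
rewrite addn2 -doubleS.
have -> : 2%:R * (h / 2) = h by field.
have Fe : `|F (euler (h / 2) u k.*2) i - F (euler h u k) i| <=
    M * (k%:R * h * expR (M * (k%:R * h)) * (M * B * h)).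
  by apply: F_lip_bnd => //; exact: euler_in.
have IHi := IH i.
rewrite eulerS.
set a := euler _ _ k.+1.*2 i; set b := euler _ _ k.*2 in Fe IHi *.
set c := euler _ _ k in Fe IHi * => abF.
have -> : a - (c i + h * F c i) =
  (a - b i - h * F b i) + ((b i - c i) + h * (F b i - F c i)) by ring.
set x := k%:R * h * _ * _ in Fe IHi.
have : h * `|F b i - F c i| <= h * (M * x) by exact: ler_wpM2l.
move=> hF.
rewrite (le_trans (ler_normD _ _))//.
have -> : k.+1%:R * h * expR (M * (k.+1%:R * h)) * (M * B * h) =
    (k%:R * h * expR (M * (k.+1%:R * h)) + h * expR (M * (k.+1%:R * h))) *
    (M * B * h).
  by rewrite -natr1; ring.
have e1 : 1 <= expR (M * (k.+1%:R * h)) by rewrite -expR0 ler_expR !mulr_ge0.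
have e2 : (1 + M * h) * expR (M * (k%:R * h)) <= expR (M * (k.+1%:R * h)).
  have -> : M * (k.+1%:R * h) = M * h + M * (k%:R * h) by rewrite -natr1; ring.
  rewrite expRD ler_wpM2r ?expR_ge0//.
  exact: expR_ge1Dx.
apply: (@le_trans _ _ (h ^+ 2 * (M * B) + (x + h * (M * x)))).
  rewrite lerD// (le_trans (ler_normD _ _))// lerD// normrM (ger0_norm h_ge0)//.
have MBh : 0 <= M * B * h by rewrite !mulr_ge0.
have -> : h ^+ 2 * (M * B) + (x + h * (M * x)) =
  (k%:R * h * ((1 + M * h) * expR (M * (k%:R * h))) + h * 1) * (M * B * h).
  by rewrite /x; ring.
by rewrite ler_wpM2r// lerD// ler_wpM2l// mulr_ge0.
Qed.

Variable u0 : I -> R.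
Hypothesis Du0 : D u0.

Let hn (n : nat) : R := h0 / 2 ^+ n.
Let hn_gt0 n : 0 < hn n. Proof. by rewrite divr_gt0// exprn_gt0. Qed.
Let hn_ok n : 0 <= hn n <= h0.
Proof.
rewrite (ltW (hn_gt0 n)) /hn ler_pdivrMr ?exprn_gt0// ler_peMr ?(ltW h0_gt0)//.
by rewrite exprn_ege1// ler1n.
Qed.
Let hnS n : hn n.+1 = hn n / 2.
Proof. by rewrite /hn exprS invfM mulrA mulrAC. Qed.

(** Piecewise constant in time rather than interpolated: every value is an iterate of the scheme,
    hence lies in [D] without any convexity of [D]. *)
Definition polygon (n : nat) (t : R) : I -> R :=
  euler (hn n) u0 (Num.truncn (t / hn n)).

Let truncP n t : 0 <= t ->
  (Num.truncn (t / hn n))%:R * hn n <= t < ((Num.truncn (t / hn n))%:R + 1) * hn n.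
Proof.
move=> t0; have := @truncn_itv R (t / hn n).
rewrite divr_ge0 ?(ltW (hn_gt0 n))// => /(_ isT).
by rewrite ler_pdivlMr// ltr_pdivrMr// natr1.
Qed.

Lemma polygon_in n t : D (polygon n t).
Proof. exact: euler_in. Qed.

Lemma polygon_step n t i : 0 <= t ->
  `|polygon n.+1 t i - polygon n t i| <=
    (h0 * (B + t * expR (M * t) * (M * B))) / 2 ^+ n.
Proof.
move=> t0.
have /andP[k1 k2] := truncP n t0.
have /andP[l1 l2] := truncP n.+1 t0.
rewrite /polygon; set k := Num.truncn (t / hn n) in k1 k2 *.
set l := Num.truncn _ in l1 l2 *.
have hn0 := hn_gt0 n.
(* The index of t on the finer grid is 2k or 2k + 1, so [euler_half] at index k leaves at most one
   half step to account for. *)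
have kl : (k.*2 <= l)%N.
  rewrite -ltnS -(ltr_nat R) -(ltr_pM2r (hn_gt0 n.+1)) -[l.+1%:R]natr1.
  by rewrite (le_lt_trans _ l2)// hnS -muln2 natrM; lra.
have lk : (l <= k.*2.+1)%N.
  rewrite -ltnS -(ltr_nat R) -(ltr_pM2r (hn_gt0 n.+1)).
  by rewrite (le_lt_trans l1)// hnS -doubleS -muln2 natrM -natr1; lra.
have [m lE] : exists m, l = (k.*2 + m)%N by exists (l - k.*2)%N; rewrite subnKC.
have m1 : m%:R <= 1 :> R.
  by rewrite (ler_nat _ m 1); move: lk; rewrite lE -addn1 leq_add2l.
have a1 := euler_lipschitz k.*2 m i (hn_ok n.+1) Du0.
have a2 := euler_half k i (hn_ok n) Du0.
rewrite -hnS -lE in a1 a2.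
have b1 : m%:R * hn n.+1 * B <= hn n * B.
  rewrite hnS ler_wpM2r//; have := mulr_ge0 (ler0n R m) (ltW hn0).
  have : m%:R * hn n <= 1 * hn n by rewrite ler_wpM2r// ltW.
  by lra.
have b2 : k%:R * hn n * expR (M * (k%:R * hn n)) * (M * B * hn n) <=
   t * expR (M * t) * (M * B * hn n).
  apply: ler_wpM2r; first by apply: mulr_ge0 (ltW hn0); exact: mulr_ge0.
  apply: ler_pM => //; first exact: mulr_ge0 (ltW hn0).
  by rewrite ler_expR ler_wpM2l.
have -> : euler (hn n.+1) u0 l i - euler (hn n) u0 k i =
  (euler (hn n.+1) u0 l i - euler (hn n.+1) u0 k.*2 i) +
  (euler (hn n.+1) u0 k.*2 i - euler (hn n) u0 k i) by ring.
rewrite (le_trans (ler_normD _ _))//.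
rewrite (le_trans (lerD (le_trans a1 b1) (le_trans a2 b2)))//.
by rewrite [leRHS]mulrAC -/(hn n) le_eqVlt; apply/orP; left; apply/eqP; ring.
Qed.

Definition flow (t : R) (i : I) : R := limn (fun n => polygon n t i).

Lemma polygon_cvg t i : 0 <= t -> polygon n t i @[n --> \oo] --> flow t i.
Proof. by move=> t0; apply: cvg_of_geometric => n; exact: polygon_step. Qed.

Lemma flow_in t : 0 <= t -> D (flow t).
Proof.
move=> t0; apply: (D_closed (polygon_in ^~ t)) => i; exact: polygon_cvg.
Qed.

Lemma flow0 i : flow 0 i = u0 i.
Proof.
rewrite /flow; apply/cvg_lim => //.
suff -> : (fun n => polygon n 0 i) = cst (u0 i) by exact: cvg_cst.
by apply/funext => n; rewrite /polygon mul0r truncn0.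
Qed.

Lemma cvg_F_polygon t i : 0 <= t -> F (polygon n t) i @[n --> \oo] --> F (flow t) i.
Proof.
move=> t0; apply/cvgrPdist_le => e e0.
have : L * \sum_j `|flow t j - polygon n t j| @[n --> \oo] -->
    L * \sum_(j : I) (0 : R).
  apply: cvgM; first exact: cvg_cst.
  apply: cvg_big => [|j _]; first exact: add_continuous.
  rewrite -(normr0 R) -(subrr (flow t j)); apply: cvg_norm.
  by apply: cvgB; [exact: cvg_cst|exact: polygon_cvg].
rewrite big1// mulr0 => /cvgr0_norm_le /(_ e e0).
apply: filterS => n /(le_trans (ler_norm _)); apply: le_trans.
by apply: F_lip; [exact: flow_in|exact: polygon_in].
Qed.

Lemma polygon_quadratic n t s i : 0 <= t -> 0 <= s ->
  `|polygon n (t + s) i - polygon n t i - s * F (polygon n t) i| <=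
    (s + hn n) ^+ 2 * (M * B) + hn n * B.
Proof.
move=> t0 s0.
have /andP[k1 k2] := truncP n t0.
have /andP[l1 l2] := truncP n (addr_ge0 t0 s0).
rewrite /polygon; set k := Num.truncn (t / hn n) in k1 k2 *.
set l := Num.truncn _ in l1 l2 *.
have hn0 := hn_gt0 n.
have kl : (k <= l)%N.
  by rewrite le_truncn// ler_wpM2r ?invr_ge0 ?(ltW hn0)// lerDl.
have [m lE] : exists m, l = (k + m)%N by exists (l - k)%N; rewrite subnKC.
rewrite lE natrD in l1 l2 *.
(* Rounding both t and t + s down to the grid changes the elapsed time s by at most one mesh, which
   vanishes in the limit. *)
have ml : m%:R * hn n <= s + hn n by lra.
have ms : `|m%:R * hn n - s| <= hn n by rewrite ler_norml; apply/andP; split; lra.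
have a1 := euler_quadratic k m i (hn_ok n) Du0.
set e := euler _ _ k in a1 *.
set f := euler _ _ _ in a1 *.
have -> : f i - e i - s * F e i =
  (f i - e i - m%:R * hn n * F e i) + (m%:R * hn n - s) * F e i by ring.
rewrite (le_trans (ler_normD _ _))// lerD//.
  apply: le_trans a1 _; apply: ler_wpM2r; first exact: mulr_ge0.
  have mh0 : 0 <= m%:R * hn n by apply: mulr_ge0 => //; exact: ltW.
  by rewrite !expr2; exact: ler_pM.
by rewrite normrM; apply: ler_pM => //; apply: F_bnd; exact: euler_in.
Qed.

(** A form of the differential equation that passes to the limit without integrals. Continuity,
    differentiability and the comparison with the chain are all derived from it. *)
Lemma flow_quadratic t s i : 0 <= t -> 0 <= s ->
  `|flow (t + s) i - flow t i - s * F (flow t) i| <= s ^+ 2 * (M * B).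
Proof.
move=> t0 s0.
have hn_cvg : hn n @[n --> \oo] --> (0 : R) by exact: cvg_half_pow.
have -> : s ^+ 2 * (M * B) = (s + 0) ^+ 2 * (M * B) + 0 * B.
  by rewrite addr0 mul0r addr0.
apply: (@ler_cvg_to _ \oo _ _
  (fun n => `|polygon n (t + s) i - polygon n t i - s * F (polygon n t) i|)
  (fun n => (s + hn n) ^+ 2 * (M * B) + hn n * B)).
- apply: cvg_norm.
  have sF : s * F (polygon n t) i @[n --> \oo] --> s * F (flow t) i.
    by apply: cvgM; [exact: cvg_cst|exact: cvg_F_polygon].
  have dp : polygon n (t + s) i - polygon n t i @[n --> \oo] -->
      flow (t + s) i - flow t i.
    by apply: cvgB; apply: polygon_cvg => //; exact: addr_ge0.
  exact: cvgB.
- apply: cvgD; last by apply: cvgM; [exact: hn_cvg|exact: cvg_cst].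
  apply: cvgM; last exact: cvg_cst.
  have sh : s + hn n @[n --> \oo] --> s + 0 by apply: cvgD; [exact: cvg_cst|].
  exact: cvgM.
- by near=> n; exact: polygon_quadratic.
Unshelve. all: by end_near. Qed.

End EulerScheme.

(** * Differential form and uniqueness *)

Lemma is_derive_bigsum (R : realType) (I : finType) (h : I -> R -> R)
    (dh : I -> R) (t : R) :
  (forall i, is_derive t 1 (h i) (dh i)) ->
  is_derive t 1 (fun s => \sum_i h i s) (\sum_i dh i).
Proof.
move=> hd.
have -> : (fun s => \sum_i h i s) = \sum_i h i by apply/funext => s; rewrite fct_sumE.
elim/big_ind2: _ => [|f df g dg Hf Hg|i _]; first exact: is_derive_cst.
  exact: is_deriveD.
exact: hd.
Qed.

Lemma is_derive_rowP (R : realType) (n : nat) (f : R -> 'rV[R]_n) (t : R)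
    (v : 'rV[R]_n) :
  is_derive t 1 f v <-> forall z, is_derive t 1 (fun s => f s 0 z) (v 0 z).
Proof.
split => [[fd fE] z|H].
  have fz : derivable (fun s => f s 0 z) t 1 by exact: (derivable_mxP f t 1).1.
  by apply: DeriveDef => //; rewrite -fE derive_mx// mxE.
have fd : derivable f t 1.
  by apply/derivable_mxP => i z; rewrite ord1; exact: ex_derive.
apply: DeriveDef => //; rewrite derive_mx//; apply/rowP => z.
by rewrite mxE derive_val.
Qed.

Lemma is_derive_linear_error (R : realType) (f : R -> R) (t df A : R) :
  (\forall h \near (0 : R), `|f (t + h) - f t - h * df| <= A * h ^+ 2) ->
  is_derive t 1 f df.
Proof.
move=> fA.
have H : h^-1 *: ((f \o shift t) (h *: (1 : R)) - f t) @[h --> 0^'] --> df.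
  apply/cvgrPdist_le => e e0; near=> h.
  have h0 : h != 0 by near: h; exact: nbhs_dnbhs_neq.
  have hA : `|f (t + h) - f t - h * df| <= A * h ^+ 2.
    by near: h; apply: nbhs_dnbhs.
  have he : `|h| <= e / (`|A| + 1).
    by near: h; apply: dnbhs0_le; rewrite divr_gt0// ltr_pwDr//.
  have -> : df - h^-1 *: ((f \o shift t) (h *: (1 : R)) - f t) =
      - (h^-1 * (f (t + h) - f t - h * df)).
    by rewrite /= [h *: 1]mulr1 [h + t]addrC -[_ *: _]/(_ * _); field.
  rewrite normrN normrM normfV ler_pdivrMl ?normr_gt0// (le_trans hA)//.
  rewrite -(real_normK (num_real h)) expr2 mulrCA ler_wpM2l//.
  move: he; rewrite ler_pdivlMr ?ltr_pwDr// mulrDr mulr1 => he.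
  have : A * `|h| <= `|A| * `|h| by rewrite ler_wpM2r// ler_norm.
  by have := normr_ge0 h; lra.
apply: DeriveDef; first by apply/cvg_ex; exists df.
exact/cvg_lim.
Unshelve. all: by end_near. Qed.

Section ODE.
Variables (R : realType) (I : finType) (F : (I -> R) -> I -> R) (L : R).
Hypothesis L_ge0 : 0 <= L.
Hypothesis F_lip : forall u v i,
  (forall j, 0 <= u j <= 1) -> (forall j, 0 <= v j <= 1) ->
  `|F u i - F v i| <= L * \sum_j `|u j - v j|.

Section Solution.
Variables (b M : R) (m : R -> I -> R).
Hypothesis b_ge0 : 0 <= b.
Hypothesis M_ge0 : 0 <= M.
Hypothesis F_bnd : forall u i, (forall j, 0 <= u j <= 1) -> `|F u i| <= b.
Hypothesis m_cube : forall t i, 0 <= t -> 0 <= m t i <= 1.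
Hypothesis m_quad : forall t s i, 0 <= t -> 0 <= s ->
  `|m (t + s) i - m t i - s * F (m t) i| <= M * s ^+ 2.

Lemma path_lipschitz t s i : 0 <= t -> 0 <= s <= 1 ->
  `|m (t + s) i - m t i| <= (b + M) * s.
Proof.
move=> t0 /andP[s0 s1].
have -> : m (t + s) i - m t i = (m (t + s) i - m t i - s * F (m t) i) + s * F (m t) i.
  by ring.
have ms := m_quad i t0 s0.
have Fb : `|s * F (m t) i| <= s * b.
  rewrite normrM ger0_norm// ler_wpM2l//.
  by apply: F_bnd => j; exact: m_cube.
have sM : M * s ^+ 2 <= M * s by rewrite ler_wpM2l// expr2 ler_piMl.
by rewrite (le_trans (ler_normD _ _))//; lra.
Qed.

(** Freezing [m] before time 0 gives a function on the whole line, as required by two-sided limits;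
    since t -> max(t, 0) is 1-Lipschitz, the forward Lipschitz bound carries over. *)
Lemma path_continuous i : continuous (fun t : R => m (Num.max t 0) i).
Proof.
move=> t.
have near_dist (r : R) : 0 < r -> \forall s \near t, `|t - s| <= r.
  move=> r0.
  by have /cvgrPdist_le/(_ r r0) : (fun s : R => s) @ t --> t by exact: cvg_id.
apply/cvgrPdist_le => e e0; near=> s.
have c0 : 0 <= b + M by exact: addr_ge0.
have max_lip : `|Num.max t 0 - Num.max s 0| <= `|t - s|.
  by rewrite ler_norml; case: (leP t 0) => ?; case: (leP s 0) => ?;
    case: (lerP t s) => ?; apply/andP; split; lra.
have ts1 : `|t - s| <= 1 by near: s; exact: near_dist.
have tse : (b + M) * `|t - s| <= e.
  have : `|t - s| <= e / (b + M + 1).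
    by near: s; apply: near_dist; rewrite divr_gt0// ltr_pwDr// addr_ge0.
  rewrite ler_pdivlMr ?ltr_pwDr// mulrDr mulr1 => H.
  by have := normr_ge0 (t - s); lra.
have key u v : 0 <= u -> u <= v -> `|u - v| <= `|t - s| ->
    `|m u i - m v i| <= (b + M) * `|t - s|.
  move=> u0 uv; rewrite distrC ger0_norm ?subr_ge0// => vu.
  have := @path_lipschitz u (v - u) i u0; rewrite (addrC u) subrK distrC => H.
  apply: le_trans (H _) _; first by rewrite subr_ge0 uv (le_trans vu).
  by rewrite ler_wpM2l.
apply: le_trans tse.
have [uv|/ltW vu] := leP (Num.max t 0) (Num.max s 0).
  by apply: key => //; rewrite le_max lexx orbT.
by rewrite distrC key// 1?distrC// le_max lexx orbT.
Unshelve. all: by end_near. Qed.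

Lemma path_derive (t : R) i : 0 < t ->
  is_derive t 1 (fun s : R => m (Num.max s 0) i) (F (m t) i).
Proof.
move=> t0; have t0' := ltW t0.
(* The second term pays for h < 0: [m_quad] only looks forward, so it is applied from t + h, and F
   (m (t + h)) is then replaced by F (m t). *)
pose A := M + L * #|I|%:R * (b + M).
have A0 : 0 <= L * #|I|%:R * (b + M) by rewrite !mulr_ge0// addr_ge0.
apply: (@is_derive_linear_error _ _ _ _ A); near=> h.
have h1 : `|h| <= 1.
  by near: h; exact: (@nbhs0_le _ R).
have ht : `|h| <= t by near: h; exact: (@nbhs0_le _ R).
have th0 : 0 <= t + h by move: ht; rewrite ler_norml => /andP[? _]; lra.
rewrite (max_idPl th0) (max_idPl t0').
have [h0|h0] := leP 0 h.
  apply: le_trans (m_quad i t0' h0) _.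
  by rewrite ler_wpM2r ?sqr_ge0// lerDl.
have hN0 : 0 <= - h by lra.
have := m_quad i th0 hN0; rewrite addrK sqrrN => H1.
have H2 : `|F (m (t + h)) i - F (m t) i| <= L * (#|I|%:R * ((b + M) * - h)).
  apply: le_trans (F_lip _ _ _) _; [by move=> j; exact: m_cube..|].
  rewrite ler_wpM2l// mulr_natl -sumr_const; apply: ler_sum => j _.
  have := @path_lipschitz (t + h) (- h) j th0; rewrite addrK distrC; apply.
  by rewrite hN0 -(ler0_norm (ltW h0)).
have -> : m (t + h) i - m t i - h * F (m t) i =
  - (m t i - m (t + h) i - - h * F (m (t + h)) i) + h * (F (m (t + h)) i - F (m t) i).
  by ring.
apply: le_trans (ler_normD _ _) _; rewrite normrN normrM (ler0_norm (ltW h0)).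
have := ler_wpM2l hN0 H2; rewrite /A; nra.
Unshelve. all: by end_near. Qed.

End Solution.

(** Gronwall by monotonicity: exp(-C s) times the squared distance has nonpositive derivative for s
    > 0, is continuous on [0, +oo[ and vanishes at 0. The choice C = 2 L [#|I|] is what
    [sum_abs_sqr_le] gives. *)
Lemma ode_unique (u v : R -> I -> R) :
  (forall t i, 0 <= t -> 0 <= u t i <= 1) ->
  (forall t i, 0 <= t -> 0 <= v t i <= 1) ->
  (forall i, {within `[0, +oo[, continuous (fun t : R => u t i)}) ->
  (forall i, {within `[0, +oo[, continuous (fun t : R => v t i)}) ->
  (forall (t : R) i, 0 < t -> is_derive t 1 (fun s : R => u s i) (F (u t) i)) ->
  (forall (t : R) i, 0 < t -> is_derive t 1 (fun s : R => v s i) (F (v t) i)) ->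
  (forall i, u 0 i = v 0 i) -> forall t i, 0 <= t -> u t i = v t i.
Proof.
move=> u01 v01 uc vc ud vd uv0 t i t0.
pose C : R := 2 * (L * #|I|%:R).
pose dist (s : R) := \sum_i (u s i - v s i) ^+ 2.
pose g (s : R) := expR (- (C * s)) * dist s.
pose ddist (s : R) := \sum_i 2 * ((u s i - v s i) * (F (u s) i - F (v s) i)).
have gd (s : R) : 0 < s -> is_derive s 1 g
    (expR (- (C * s)) * ddist s + dist s * (- C * expR (- (C * s)))).
  move=> s0.
  have d1 : is_derive s 1 dist (ddist s).
    apply: is_derive_bigsum => j.
    have d0 := is_deriveB (ud s j s0) (vd s j s0).
    have := is_deriveX 2 d0.
    by rewrite /= expr1 -[_ *: _]/(_ * _) mulrA.
  have d2 : is_derive s 1 (fun s : R => expR (- (C * s))) (- C * expR (- (C * s))).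
    have -> : (fun s => expR (- (C * s))) = expR \o ( *%R (- C)).
      by apply/funext => x /=; rewrite mulNr.
    have dC : is_derive s 1 ( *%R (- C)) (- C).
      apply: (@is_derive_linear_error _ _ _ _ 0); apply: filterE => h.
      by rewrite (_ : _ - _ = 0) ?normr0 ?mul0r//; ring.
    have -> : - C * expR (- (C * s)) = expR (- C * s) * (- C).
      by rewrite -(mulNr C s) mulrC.
    exact: (is_derive1_comp (is_derive_expR (- C * s)) dC).
  exact: is_deriveM.
have g_derivable s : s \in `]0, +oo[ -> derivable g s 1.
  by rewrite in_itv/= andbT => /gd [].
have g_decr s : s \in `]0, +oo[ -> g^`()%classic s <= 0.
  rewrite in_itv/= andbT => s0; rewrite derive1E.
    have [_ ->] := gd s s0.
    have -> : expR (- (C * s)) * ddist s + dist s * (- C * expR (- (C * s))) =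
      expR (- (C * s)) * (ddist s - C * dist s) by ring.
    rewrite pmulr_rle0 ?expR_gt0// subr_le0 /ddist /C -big_distrr/= -[leRHS]mulrA.
    rewrite ler_wpM2l//.
    apply: (@le_trans _ _ (\sum_i `|u s i - v s i| * (L * \sum_j `|u s j - v s j|))).
      apply: ler_sum => j _; apply: le_trans (ler_norm _) _; rewrite normrM.
      by rewrite ler_wpM2l// F_lip// => k; [apply: u01|apply: v01]; exact: ltW.
    under eq_bigr do rewrite mulrCA.
    by rewrite -big_distrr/= -[leRHS]mulrA ler_wpM2l// sum_abs_sqr_le.
have g_cont : {within `[0, +oo[, continuous g}.
  have cdist : {within `[0, +oo[, continuous dist}.
    move=> s; apply: cvg_big => [|j _]; first exact: add_continuous.
    have cB : (fun s => u s j - v s j) @ nbhs (s : subspace `[0, +oo[) -->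
        u s j - v s j by apply: cvgB; [exact: uc|exact: vc].
    exact: (cvgM cB cB).
  have cexp : {within `[0, +oo[, continuous (fun s : R => expR (- (C * s)))}.
    apply: continuous_subspaceT => s; apply: continuous_comp.
      by apply: cvgN; apply: cvgM; [exact: cvg_cst|exact: cvg_id].
    exact: continuous_expR.
  by move=> s; apply: cvgM; [exact: cexp|exact: cdist].
have g_le : g t <= g 0.
  exact: (ler0_derive1_nincry g_derivable g_decr g_cont (lexx 0) t0).
have dist0 : dist 0 = 0 by rewrite /dist big1// => j _; rewrite uv0 subrr expr0n.
have gt0 : g t <= 0 by move: g_le; rewrite [g 0]/g dist0 mulr0.
have dt : dist t <= 0 by move: gt0; rewrite /g pmulr_rle0// expR_gt0.
have : (u t i - v t i) ^+ 2 <= 0.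
  apply: le_trans dt.
  by apply: (@term_le_sum _ _ (fun i => (u t i - v t i) ^+ 2)) => j; exact: sqr_ge0.
by rewrite le_eqVlt ltNge sqr_ge0 orbF sqrf_eq0 subr_eq0 => /eqP.
Qed.

End ODE.

(** * Maximal inequality for finite Markov chains *)

Section FiniteValued.
Context {R : realType} {d : measure_display} {Omega : measurableType d}.
Variables (P : probability Omega R) (T : finType) (Z : Omega -> T).
Hypothesis Z_meas : forall s, measurable [set w | Z w = s].

Lemma probabilityK (A : set Omega) : measurable A -> (fine (P A))%:E = P A.
Proof. by move=> mA; rewrite fineK// fin_num_measure. Qed.

Lemma finite_valued_measurable (Q : T -> Prop) : measurable [set w | Q (Z w)].
Proof.
have -> : [set w | Q (Z w)] = \bigcup_(s in [set s | Q s]) [set w | Z w = s].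
  apply/seteqP; split => [w Qw|w [s Qs /= ->]//].
  by exists (Z w).
exact: fin_bigcup_measurable.
Qed.

Lemma fine_partition (A : set Omega) : measurable A ->
  fine (P A) = \sum_s fine (P (A `&` [set w | Z w = s])).
Proof.
move=> mA.
have mAs s : measurable (A `&` [set w | Z w = s]) by exact: measurableI.
apply: EFin_inj; rewrite -sumEFin probabilityK//.
under eq_bigr do rewrite probabilityK//.
have {1}-> : A = \bigcup_(s in [set: T]) (A `&` [set w | Z w = s]).
  apply/seteqP; split => [w Aw|w [s _ []]//].
  by exists (Z w).
have tA : trivIset [set: T] (fun s => A `&` [set w | Z w = s]).
  apply/trivIsetP => i j _ _ ij; rewrite -subset0 => w [[_ /= Zi] [_ /= Zj]].
  by rewrite -Zi -Zj eqxx in ij.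
rewrite measure_fin_bigcup//; last exact: finite_finset.
rewrite (fsbigE (index_enum T))//; first by apply: eq_bigl => s; rewrite in_setT.
  exact: index_enum_uniq.
by move=> s _; rewrite mem_index_enum.
Qed.

Lemma expectation_finite_valued (g : T -> R) : (forall s, 0 <= g s) ->
  ('E_P[g \o Z] = (\sum_s g s * fine (P [set w | Z w = s]))%:E)%E.
Proof.
move=> g0; rewrite unlock -sumEFin.
under eq_bigr do rewrite EFinM probabilityK//.
have -> : (fun w => ((g \o Z) w)%:E) =
   (fun w => \sum_s ((g s)%:E * (\1_[set w | Z w = s] w)%:E))%E.
  apply/funext => w /=; rewrite (bigD1 (Z w))//= big1 ?adde0.
    by rewrite indicE mem_set//= mule1.
  by move=> s sZ; rewrite indicE memNset ?mule0//= => ZE; rewrite ZE eqxx in sZ.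
rewrite ge0_integral_sum//.
- apply: eq_bigr => s _; rewrite ge0_integralZl//.
  + by rewrite integral_indic// setIT.
  + by apply/measurable_EFinP; exact: measurable_indic.
  + by rewrite lee_fin.
- move=> s; apply: measurable_funeM; apply/measurable_EFinP.
  exact: measurable_indic.
- by move=> s w _; rewrite mule_ge0// lee_fin.
Qed.

End FiniteValued.

Section MaximalInequality.
Context {R : realType} {d : measure_display} {Omega : measurableType d}.
Variables (P : probability Omega R) (S : finType) (Y : nat -> Omega -> S).
Variable (p : S -> S -> R).
Hypothesis Y_meas : forall n s, measurable [set w | Y n w = s].
Hypothesis p_ge0 : forall x y, 0 <= p x y.
Hypothesis p_sum : forall x, \sum_y p x y = 1.
Hypothesis Y_markov : forall n (s : nat -> S),
  P [set w | forall i, (i <= n.+1)%N -> Y i w = s i] =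
  (P [set w | forall i, (i <= n)%N -> Y i w = s i] * (p (s n) (s n.+1))%:E)%E.
Variable bad : nat -> pred S.

Definition avoid (k : nat) : set Omega :=
  [set w | forall i, (i <= k)%N -> ~~ bad i (Y i w)].
(** Sub-probability law of the chain killed at its first bad time. Its linear recursion [aliveS]
    takes the place of stopping times and conditional expectations. *)
Definition alive (k : nat) (x : S) : R :=
  fine (P (avoid k `&` [set w | Y k w = x])).

Let history (k : nat) (w : Omega) : {ffun 'I_k.+1 -> S} := [ffun i => Y (val i) w].

Lemma history_measurable (k : nat) s : measurable [set w | history k w = s].
Proof.
have -> : [set w | history k w = s] =
    \bigcap_(i in [set: 'I_k.+1]) [set w | Y i w = s i].
  apply/seteqP; split => [w /= <- i _ /=|w hw]; first by rewrite ffunE.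
  by apply/ffunP => i; rewrite ffunE; exact: hw.
by apply: fin_bigcap_measurable.
Qed.

Lemma avoid_measurable k : measurable (avoid k).
Proof.
rewrite (_ : avoid k = \bigcap_(i in `I_k.+1) [set w | ~~ bad i (Y i w)]).
  apply: fin_bigcap_measurable => // i _.
  exact: (finite_valued_measurable (Y_meas i) (fun s => ~~ bad i s)).
by apply/seteqP; split => w h i /=; apply: h.
Qed.

Lemma alive_ge0 k x : 0 <= alive k x.
Proof. exact: fine_ge0. Qed.

Lemma alive_sum k : fine (P (avoid k)) = \sum_x alive k x.
Proof. by apply: fine_partition => //; exact: avoid_measurable. Qed.

Lemma alive0 x : alive 0 x = (~~ bad 0%N x)%:R * fine (P [set w | Y 0%N w = x]).
Proof.
rewrite /alive; case: (boolP (bad 0%N x)) => bx /=.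
  rewrite mul0r (_ : _ `&` _ = set0) ?measure0// -subset0 => w /= [av Yx].
  by have := av 0%N isT; rewrite Yx bx.
rewrite mul1r; congr (fine (P _)); apply/seteqP; split => [w []//|w /= Yx].
by split => // -[|//] _; rewrite Yx.
Qed.

Let follows (k : nat) (s : nat -> S) : set Omega :=
  [set w | forall i, (i <= k)%N -> Y i w = s i].

Let followsE k (s : {ffun 'I_k.+1 -> S}) w :
  history k w = s <-> follows k (fun i => s (inord i)) w.
Proof.
split => [<- i ik|h]; first by rewrite ffunE /= inordK.
by apply/ffunP => i; rewrite ffunE (h i (ltn_ord i)) inord_val.
Qed.

Let good k (s : {ffun 'I_k.+1 -> S}) := [forall i : 'I_k.+1, ~~ bad i (s i)].

(** The Markov hypothesis speaks of complete trajectories only, so the killed law has to be split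
    into those before it can be used. *)
Lemma alive_path k x : alive k x =
  \sum_(s : {ffun 'I_k.+1 -> S} | good s && (s ord_max == x))
     fine (P (follows k (fun i => s (inord i)))).
Proof.
rewrite /alive (fine_partition P (@history_measurable k)); last first.
  by apply: measurableI => //; exact: avoid_measurable.
rewrite [RHS]big_mkcond; apply: eq_bigr => s _; case: ifPn => [/andP[gs /eqP sx]|ngs].
  congr (fine (P _)); apply/seteqP; split => [w [_ /followsE]//|w /followsE hs].
  split => //; rewrite -hs in gs sx; split => [i ik|] /=; last first.
    by rewrite -sx ffunE.
  have /forallP/(_ (inord i)) := gs.
  by rewrite ffunE /= inordK.
rewrite (_ : _ `&` _ = set0) ?measure0// -subset0 => w /= [[av Yx] hs].
move/negP: ngs; apply; apply/andP; split.
  by apply/forallP => i; rewrite -hs ffunE; apply: av; rewrite -ltnS.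
by rewrite -hs ffunE Yx.
Qed.

Lemma aliveS k y :
  alive k.+1 y = (~~ bad k.+1 y)%:R * \sum_x alive k x * p x y.
Proof.
case: (boolP (bad k.+1 y)) => by_ /=.
  rewrite mul0r /alive (_ : _ `&` _ = set0) ?measure0// -subset0 => w /= [av Yx].
  by have := av k.+1 (leqnn _); rewrite Yx by_.
rewrite mul1r.
transitivity (\sum_(s : {ffun 'I_k.+1 -> S} | good s)
   fine (P (follows k (fun i => s (inord i)))) * p (s ord_max) y); last first.
  under [RHS]eq_bigr do rewrite alive_path big_distrl/=.
  rewrite (exchange_big_dep (fun s => good s))/=; last by move=> x s _ /andP[].
  apply: eq_bigr => s gs; rewrite (bigD1 (s ord_max)) ?gs ?eqxx//= big1 ?addr0//.
  by move=> x /andP[/eqP->]; rewrite eqxx.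
rewrite /alive (fine_partition P (@history_measurable k)); last first.
  by apply: measurableI => //; exact: avoid_measurable.
rewrite [RHS]big_mkcond; apply: eq_bigr => s _; case: ifPn => [gs|ngs].
  (* The trajectory [s] continued by [y] at time k + 1; its values after k + 1 are never read. *)
  pose s' i := if (i <= k)%N then s (inord i) else y.
  have mfollows j f : measurable (follows j f).
    rewrite (_ : follows j f = \bigcap_(i in `I_j.+1) [set w | Y i w = f i]).
      exact: fin_bigcap_measurable.
    by apply/seteqP; split => w h i /=; apply: h.
  have -> : avoid k.+1 `&` [set w | Y k.+1 w = y] `&` [set w | history k w = s]
      = follows k.+1 s'.
    apply/seteqP; split => [w [[av /= Yy] /followsE hs] i|w hs].
      rewrite leq_eqVlt => /predU1P[->|]; first by rewrite /s' ltnn.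
      by rewrite ltnS /s' => ik; rewrite ik hs.
    have h : history k w = s.
      by apply/followsE => i ik; rewrite hs /s' ?ik// ltnW.
    split => //; split => /=; last by rewrite hs// /s' ltnn.
    move=> i; rewrite leq_eqVlt => /predU1P[->|].
      by rewrite hs// /s' ltnn.
    rewrite ltnS => ik; rewrite -h in gs; have /forallP/(_ (inord i)) := gs.
    by rewrite ffunE /= inordK.
  have := Y_markov k s'; rewrite -/(follows k s') -/(follows k.+1 s').
  have -> : follows k s' = follows k (fun i => s (inord i)).
    by apply/seteqP; split => w h i ik; rewrite h// /s' ik.
  rewrite -[P (follows k _)]probabilityK// -EFinM => -> /=.
  rewrite /s' leqnn ltnn (_ : inord k = ord_max)//.
  by apply/val_inj; rewrite /= inordK.
rewrite (_ : _ `&` _ = set0) ?measure0// -subset0 => w /= [[av Yx] hs].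
move/negP: ngs; apply; apply/forallP => i; rewrite -hs ffunE; apply: av.
by rewrite ltnW.
Qed.

(* The chain is stopped at its first bad time: mass that is still alive is
   weighted by [G k], stopped mass by [c], and the total weight [Phi k] does not
   increase. *)
Lemma maximal_inequality (m : nat) (G : nat -> S -> R) (c : R) :
  (forall k x, (k <= m)%N -> 0 <= G k x) ->
  (forall k x, (k <= m)%N -> bad k x -> c <= G k x) ->
  (forall k x, (k < m)%N -> \sum_y p x y * G k.+1 y <= G k x) ->
  c * fine (P (~` avoid m)) <= \sum_x fine (P [set w | Y 0%N w = x]) * G 0%N x.
Proof.
move=> G0 badG superG.
have sum0 : \sum_x fine (P [set w | Y 0%N w = x]) = 1.
  have := fine_partition P (Y_meas 0%N) measurableT.
  rewrite probability_setT /= => ->; apply: eq_bigr => x _.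
  by rewrite setTI.
pose Phi k := \sum_x alive k x * (G k x - c) + c.
have PhiE k : Phi k = \sum_x alive k x * G k x + c * (1 - \sum_x alive k x).
  rewrite /Phi; under eq_bigr do rewrite mulrBr.
  by rewrite sumrB -big_distrl/=; ring.
(* Mass killed at a bad state passes from weight [G k x] to weight [c], which is not larger there:
   deleting the bad terms only removes nonnegative summands. *)
have drop_bad k (q : S -> R) : (k <= m)%N -> (forall x, 0 <= q x) ->
    \sum_x (~~ bad k x)%:R * q x * (G k x - c) <= \sum_x q x * (G k x - c).
  move=> km q0; apply: ler_sum => x _; case: (boolP (bad k x)) => bx /=.
    by rewrite !mul0r mulr_ge0// subr_ge0 badG.
  by rewrite mul1r.
have PhiS k : (k < m)%N -> Phi k.+1 <= Phi k.
  move=> km; rewrite /Phi lerD2r.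
  under eq_bigr do rewrite aliveS.
  apply: le_trans (drop_bad _ _ km _) _.
    by move=> y; apply: sumr_ge0 => x _; rewrite mulr_ge0// alive_ge0.
  under eq_bigr do rewrite big_distrl/=.
  rewrite exchange_big/=; apply: ler_sum => x _.
  under eq_bigr do rewrite -mulrA.
  rewrite -big_distrr/= ler_wpM2l ?alive_ge0//.
  under eq_bigr do rewrite mulrBr.
  by rewrite sumrB -big_distrl/= p_sum mul1r lerD2r superG.
have Phim : Phi m <= Phi 0%N.
  have : forall k, (k <= m)%N -> Phi k <= Phi 0%N.
    elim=> // k IH km; apply: le_trans (PhiS _ km) _; exact: IH (ltnW km).
  exact.
have -> : fine (P (~` avoid m)) = 1 - \sum_x alive m x.
  rewrite -alive_sum probability_setC ?fineB//=; last exact: avoid_measurable.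
  by rewrite fin_num_measure//; exact: avoid_measurable.
apply: (@le_trans _ _ (Phi m)).
  by rewrite PhiE lerDr sumr_ge0// => x _; rewrite mulr_ge0 ?alive_ge0 ?G0.
apply: (le_trans Phim); rewrite /Phi.
under eq_bigr do rewrite alive0.
apply: le_trans (lerD (drop_bad _ _ (leq0n m) _) (lexx c)) _.
  by move=> x; exact: fine_ge0.
under eq_bigr do rewrite mulrBr.
by rewrite sumrB -big_distrl/= sum0 mul1r subrK.
Qed.

End MaximalInequality.

(** * From dyadic grids to all times *)

Section GridEvents.
Context {R : realType} {d : measure_display} {Omega : measurableType d}.
Variables (P : probability Omega R) (S : finType) (X : R -> Omega -> S).
Variables (T : R) (bad : R -> pred S).
Hypothesis T_gt0 : 0 < T.
Hypothesis X_meas : forall t s, 0 <= t -> measurable [set w | X t w = s].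
Hypothesis X_right : forall w t, 0 <= t -> \forall u \near t^'+, X u w = X t w.
Hypothesis bad_right : forall t x, 0 <= t -> bad t x ->
  \forall u \near t^'+, bad u x.

Definition some_time : set Omega :=
  [set w | exists2 t, 0 <= t <= T & bad t (X t w)].
Definition grid_time (n k : nat) : R := k%:R * (T / 2 ^+ n).
Definition some_grid_time (n : nat) : set Omega :=
  [set w | exists2 k, (k <= 2 ^ n)%N & bad (grid_time n k) (X (grid_time n k) w)].

Let mesh_gt0 n : 0 < T / 2 ^+ n. Proof. by rewrite divr_gt0// exprn_gt0. Qed.

Lemma grid_time_ge0 n k : 0 <= grid_time n k.
Proof. by rewrite mulr_ge0// ltW. Qed.

Lemma grid_time_le n k : (k <= 2 ^ n)%N = (grid_time n k <= T).
Proof.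
rewrite /grid_time mulrCA -[leRHS]mulr1 ler_pM2l// ler_pdivrMr ?exprn_gt0// mul1r.
by rewrite -natrX ler_nat.
Qed.

Lemma some_grid_time_measurable n : measurable (some_grid_time n).
Proof.
have -> : some_grid_time n = \bigcup_(k in `I_(2 ^ n).+1)
    [set w | bad (grid_time n k) (X (grid_time n k) w)].
  by apply/seteqP; split => w [k kn bk]; exists k.
apply: fin_bigcup_measurable => // k _.
by apply: (finite_valued_measurable _ (bad (grid_time n k))) => s;
  exact: X_meas (grid_time_ge0 _ _).
Qed.

Lemma some_grid_time_nondecreasing :
  {homo some_grid_time : n m / (n <= m)%N >-> (n <= m)%O}.
Proof.
move=> n m nm; apply/subsetPset => w [k kn bk].
have gE : grid_time n k = grid_time m (k * 2 ^ (m - n)).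
  rewrite /grid_time natrM natrX -[in RHS](subnK nm) exprD invfM.
  by rewrite addnK mulrA mulrACA mulrCA; field; rewrite !expf_neq0.
exists (k * 2 ^ (m - n))%N; last by rewrite -gE.
by rewrite grid_time_le -gE -grid_time_le.
Qed.

(** Path and [bad] are both stable to the right, so a bad time t < T is followed by an interval of
    bad times, which every fine enough grid meets before T. This also turns an uncountable union
    into a countable one, hence an event. *)
Lemma some_timeE : some_time = \bigcup_n some_grid_time n.
Proof.
apply/seteqP; split => [w [t /andP[t0 tT] bt]|w [n _ [k kn bk]]]; last first.
  by exists (grid_time n k) => //; rewrite grid_time_ge0 -grid_time_le.
have [tE|t_neq] := eqVneq t T.
  (* The neighbourhood to the right of T leaves [0, T], but T itself is the grid point of index 1 at
     level 0. *)
  exists 0%N => //; exists 1%N => //.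
  by rewrite /grid_time mul1r expr0 divr1 -tE.
have tltT : t < T by rewrite lt_neqAle t_neq.
have : \forall u \near t^'+, bad u (X u w).
  near=> u; have -> : X u w = X t w by near: u; exact: X_right.
  by near: u; exact: bad_right.
move=> [rho /= rho0 bu].
have : \forall n \near \oo, T / 2 ^+ n < Num.min rho (T - t).
  apply: (cvgr_lt 0); first exact: cvg_half_pow.
  by rewrite lt_min rho0 subr_gt0.
move=> [n _ /(_ n (leqnn n))]; rewrite /= lt_min => /andP[hrho hT].
have h0 := mesh_gt0 n.
(* The first grid index strictly after t, because the right neighbourhood excludes t itself. *)
pose k := (Num.truncn (t / (T / 2 ^+ n))).+1.
have kP : t < grid_time n k <= t + T / 2 ^+ n.
  have := @truncn_itv R (t / (T / 2 ^+ n)).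
  rewrite divr_ge0 ?(ltW h0)// => /(_ isT) /andP[].
  rewrite ler_pdivlMr// ltr_pdivrMr// /grid_time /k => le1 ->.
  by rewrite /= -natr1 mulrDl mul1r lerD2r.
have /andP[k1 k2] := kP.
exists n => //; exists k; first by rewrite grid_time_le; lra.
apply: bu => //=; rewrite /ball_/= distrC gtr0_norm; lra.
Unshelve. all: by end_near. Qed.

Lemma some_time_measurable : measurable some_time.
Proof.
rewrite some_timeE; apply: bigcupT_measurable => n.
exact: some_grid_time_measurable.
Qed.

Lemma some_time_le (a : R) :
  (\forall n \near \oo, fine (P (some_grid_time n)) <= a) ->
  fine (P some_time) <= a.
Proof.
move=> na.
have := nondecreasing_cvg_mu (mu := P) some_grid_time_measurable.
rewrite -some_timeE => /(_ some_time_measurable some_grid_time_nondecreasing) cvgP.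
have /fine_cvgP[_ cvgf] :
    P (some_grid_time n) @[n --> \oo] --> (fine (P some_time))%:E.
  by rewrite probabilityK//; exact: some_time_measurable.
exact: (cvgr_to_le cvgf).
Qed.

End GridEvents.

(** * Density-dependent chains *)

(** Finiteness of [S] makes the pointwise limits uniform: one h serves all pairs of states, as
    iterating along a grid requires. *)
Lemma near0_rate_error (R : realType) (S : finType) (p : R -> S -> S -> R)
    (psi : S -> S -> R) (eta : R) : has_jump_rates p psi -> 0 < eta ->
  \forall h \near 0^'+, forall x y, x != y ->
    `|p h x y - h * psi x y| <= eta * h.
Proof.
move=> p_psi eta0; apply: filter_forall => x; apply: filter_forall => y.
have [->|xy] := eqVneq x y; first by apply: nearW.
have /cvgrPdist_le/(_ _ eta0) := p_psi x y xy.
move=> H; near=> h => _.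
have h0 : 0 < h by near: h; exact: nbhs_right_gt.
have : `|psi x y - p h x y / h| <= eta by near: h.
rewrite -(ler_pM2r h0) -[X in _ * X <= _](gtr0_norm h0) -normrM.
rewrite mulrBl divfK ?gt_eqF//.
by rewrite distrC (mulrC (psi _ _)).
Unshelve. all: by end_near. Qed.

Section DensityDependentChain.
Variables (R : realType) (S I : finType).
Variables (psi : S -> S -> R) (q : S -> I -> R) (F : (I -> R) -> I -> R).
Variables (L b d1 d2 : R).
Hypothesis q_cube : forall x i, 0 <= q x i <= 1.
Hypothesis L_ge0 : 0 <= L.
Hypothesis F_lip : forall u v i,
  (forall j, 0 <= u j <= 1) -> (forall j, 0 <= v j <= 1) ->
  `|F u i - F v i| <= L * \sum_j `|u j - v j|.
Hypothesis F_bnd : forall u i, (forall j, 0 <= u j <= 1) -> `|F u i| <= b.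
Hypothesis drift_err : forall x i,
  `|\sum_(y | y != x) psi x y * (q y i - q x i) - F (q x) i| <= d1.
Hypothesis quad_err : forall x i,
  \sum_(y | y != x) psi x y * (q y i - q x i) ^+ 2 <= d2.
Variables (m : R -> I -> R) (M : R).
Hypothesis m_cube : forall t i, 0 <= t -> 0 <= m t i <= 1.
Hypothesis m_quad : forall t s i, 0 <= t -> 0 <= s ->
  `|m (t + s) i - m t i - s * F (m t) i| <= M * s ^+ 2.

Definition sqdist (t : R) (x : S) : R := \sum_i (q x i - m t i) ^+ 2.

Lemma sqdist_ge0 t x : 0 <= sqdist t x.
Proof. by apply: sumr_ge0 => i _; exact: sqr_ge0. Qed.

(** [C] is the Gronwall constant of the squared distance. In [delta], each coordinate contributes 2
    [d1] from the cross term 2 (q - m) times the drift error, as |q - m| <= 1, and [d2] from the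
    squared jumps. *)
Let C : R := 2 * L * #|I|%:R.
Let delta : R := #|I|%:R * (2 * d1 + d2).

(** Here [a] is q_i(x) - m_i(t), [u] the increment of m_i over [t, t + h], [f] and [g] the field at
    q(x) and at m(t), [D] the actual drift of q_i at x and [Q] its rate of squared jumps. The left
    side is the first-order expectation of the squared distance in coordinate i at time t + h. *)
Lemma coordinate_step (a u f g D Q h : R) : 0 <= h <= 1 ->
  `|u - h * g| <= M * h ^+ 2 -> `|D - f| <= d1 -> Q <= d2 ->
  `|a| <= 1 -> `|a - u| <= 1 -> `|f| <= b -> `|g| <= b ->
  (a - u) ^+ 2 + h * (2 * (a - u) * D + Q) <=
    a ^+ 2 + 2 * h * (a * (f - g)) + h * (2 * d1 + d2) +
    h ^+ 2 * (2 * M + (b + M) ^+ 2 + 2 * (b + M) * b).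
Proof.
move=> /andP[h0 h1] ug Df Qd a1 au1 fb gb.
have M0 : 0 <= M * h ^+ 2 by exact: le_trans ug.
have b0 : 0 <= b by exact: le_trans fb.
have d0 : 0 <= d1 by exact: le_trans Df.
have hh : h ^+ 2 <= h by rewrite expr2; nra.
(* Apart from the immediate case h = 0, the sign of [M] can be read off [0 <= M * h ^+ 2]. *)
have [hE|hn0] := eqVneq h 0.
  move: ug; rewrite hE !(expr2 0) !(mul0r, mulr0, subr0) normr_le0 => /eqP->.
  by rewrite !(subr0, mul0r, mulr0, addr0).
have hgt : 0 < h by rewrite lt_def hn0.
have M00 : 0 <= M by move: M0; rewrite pmulr_lge0// exprn_gt0.
have Mh : M * h ^+ 2 <= M * h by rewrite ler_wpM2l.
have ub : `|u| <= h * (b + M).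
  have -> : u = (u - h * g) + h * g by ring.
  rewrite (le_trans (ler_normD _ _))// normrM (ger0_norm h0).
  have : h * `|g| <= h * b by rewrite ler_wpM2l.
  by lra.
have t1 : - 2 * a * u <= - 2 * a * (h * g) + 2 * (M * h ^+ 2).
  have : `|a * (u - h * g)| <= 1 * (M * h ^+ 2) by rewrite normrM ler_pM.
  by rewrite ler_norml => /andP[? ?]; lra.
have t2 : u ^+ 2 <= h ^+ 2 * (b + M) ^+ 2.
  by rewrite -exprMn -(real_normK (num_real u)) !expr2 ler_pM.
have t3 : (a - u) * D <= (a - u) * f + d1.
  have : `|(a - u) * (D - f)| <= 1 * d1 by rewrite normrM ler_pM.
  by rewrite ler_norml => /andP[? ?]; lra.
have t4 : - (u * f) <= h * (b + M) * b.
  have : `|u * f| <= h * (b + M) * b by rewrite normrM ler_pM.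
  by rewrite ler_norml => /andP[? ?]; lra.
have t3h : 2 * h * ((a - u) * D) <= 2 * h * ((a - u) * f + d1).
  by rewrite ler_wpM2l// mulr_ge0.
have t4h : 2 * h * (- (u * f)) <= 2 * h * (h * (b + M) * b).
  by rewrite ler_wpM2l// mulr_ge0.
have t5 : h * Q <= h * d2 by rewrite ler_wpM2l.
rewrite sqrrB; nra.
Qed.

Variable p : R -> S -> S -> R.
Hypothesis p_trans : transition_function p.
Hypothesis p_psi : has_jump_rates p psi.

Lemma sqdist_step (eta : R) : 0 < eta ->
  \forall h \near 0^'+, forall t x, 0 <= t ->
    \sum_y p h x y * sqdist (t + h) y <=
      (1 + C * h) * sqdist t x + (delta + eta) * h.
Proof.
move=> eta0.
have [p0 p1 _ _] := p_trans.
pose c0 : R := 2 * M + (b + M) ^+ 2 + 2 * (b + M) * b.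
pose n : R := #|I|%:R.
pose k : R := #|S|%:R.
have k0 : 0 <= k * n by rewrite mulr_ge0.
(* Half of [eta] covers the rate errors: at most k target states, each with error e1 h and a change
   of squared distance at most n. The other half covers the h^2 terms, of total n c0 h^2. The added
   1 keeps the divisor positive. *)
pose e1 : R := eta / 2 / (k * n + 1).
have e10 : 0 < e1 by rewrite !divr_gt0// ltr_pwDr.
near=> h => t x t0.
have h0 : 0 < h by near: h; exact: nbhs_right_gt.
have h1 : h <= 1 by near: h; exact: nbhs_right_le.
have perr : forall x y, x != y -> `|p h x y - h * psi x y| <= e1 * h.
  by near: h; exact: near0_rate_error.
have hc : h * (n * c0) <= eta / 2.
  have : h <= eta / 2 / (`|n * c0| + 1).
    by near: h; apply: nbhs_right_le; rewrite !divr_gt0// ltr_pwDr.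
  rewrite ler_pdivlMr ?ltr_pwDr// mulrDr mulr1 => hle.
  have : h * (n * c0) <= h * `|n * c0| by rewrite ler_wpM2l ?(ltW h0)// ler_norm.
  by lra.
have th0 : 0 <= t + h by rewrite addr_ge0// ltW.
pose v := sqdist (t + h).
have vdiff y : `|v y - v x| <= n.
  rewrite /v /sqdist -sumrB (le_trans (ler_norm_sum _ _ _))//.
  rewrite /n -sumr_const; apply: ler_sum => i _.
  have sq_le1 z : (q z i - m (t + h) i) ^+ 2 <= 1.
    have := q_cube z i; have := m_cube i th0 => /andP[? ?] /andP[? ?].
    rewrite -[leRHS](expr1n _ 2) -(real_normK (num_real _)).
    by rewrite ler_pXn2r ?nnegrE// ler_norml; apply/andP; split; lra.
  have := sq_le1 y; have := sq_le1 x.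
  have := sqr_ge0 (q y i - m (t + h) i); have := sqr_ge0 (q x i - m (t + h) i).
  by move=> ? ? ? ?; rewrite ler_norml; apply/andP; split; lra.
have step1 : \sum_y p h x y * v y <=
    v x + h * (\sum_(y | y != x) psi x y * (v y - v x)) + eta / 2 * h.
  have -> : \sum_y p h x y * v y = v x + \sum_(y | y != x) p h x y * (v y - v x).
    have -> : \sum_y p h x y * v y =
        \sum_y p h x y * v x + \sum_y p h x y * (v y - v x).
      by rewrite -big_split/=; apply: eq_bigr => y _; ring.
    rewrite -big_distrl/= p1 ?(ltW h0)// mul1r; congr (_ + _).
    by rewrite (bigD1 x)//= subrr mulr0 add0r.
  rewrite -addrA lerD2l big_distrr/= -lerBlDl -sumrB.
  apply: (@le_trans _ _ (\sum_(y | y != x) e1 * h * n)).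
    apply: ler_sum => y yx; rewrite mulrA -mulrBl.
    apply: le_trans (ler_norm _) _; rewrite normrM; apply: ler_pM => //.
    by apply: perr; rewrite eq_sym.
  rewrite sumr_const -[leLHS]mulr_natl.
  apply: (@le_trans _ _ (k * (e1 * h * n))).
    rewrite ler_wpM2r ?ler_nat ?max_card//.
    by rewrite mulr_ge0// mulr_ge0// ltW.
  have -> : k * (e1 * h * n) = (e1 * (k * n)) * h by ring.
  rewrite ler_wpM2r ?(ltW h0)//.
  rewrite /e1 mulrAC ler_pdivrMr ?ltr_pwDr//.
  by rewrite ler_wpM2l ?divr_ge0 ?(ltW eta0)// lerDl.
apply: (le_trans step1).
(* Expanding each square around q(x) separates the drift, controlled by [drift_err], from the
   squared jumps, controlled by [quad_err]. *)
have -> : \sum_(y | y != x) psi x y * (v y - v x) =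
    \sum_i (2 * (q x i - m (t + h) i) *
      (\sum_(y | y != x) psi x y * (q y i - q x i)) +
      \sum_(y | y != x) psi x y * (q y i - q x i) ^+ 2).
  under eq_bigr do rewrite /v /sqdist -sumrB big_distrr/=.
  rewrite exchange_big/=; apply: eq_bigr => i _.
  by rewrite big_distrr/= -big_split/=; apply: eq_bigr => y _; ring.
pose a i := q x i - m t i.
pose f i := F (q x) i.
pose g i := F (m t) i.
have step2 : v x + h * \sum_i (2 * (q x i - m (t + h) i) *
      (\sum_(y | y != x) psi x y * (q y i - q x i)) +
      \sum_(y | y != x) psi x y * (q y i - q x i) ^+ 2) <=
    sqdist t x + 2 * h * (\sum_i a i * (f i - g i)) + delta * h + h ^+ 2 * (n * c0).
  have -> : sqdist t x + 2 * h * (\sum_i a i * (f i - g i)) + delta * h +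
      h ^+ 2 * (n * c0) = \sum_i (a i ^+ 2 + 2 * h * (a i * (f i - g i)) +
        h * (2 * d1 + d2) + h ^+ 2 * c0).
    have sum_cst (e : R) : \sum_(i : I) e = n * e.
      by rewrite sumr_const -[LHS]mulr_natl.
    rewrite !big_split/= !sum_cst /delta -/n -[\sum_i 2 * h * _]big_distrr/= /sqdist.
    by congr (_ + _ + _ + _); ring.
  rewrite /v /sqdist big_distrr/= -big_split/=; apply: ler_sum => i _.
  have -> : q x i - m (t + h) i = a i - (m (t + h) i - m t i) by rewrite /a; ring.
  have := q_cube x i; have := m_cube i th0; have := m_cube i t0.
  move=> /andP[? ?] /andP[? ?] /andP[? ?].
  apply: coordinate_step => //.
  - by rewrite (ltW h0).
  - by apply: m_quad => //; exact: ltW.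
  - by rewrite /a ler_norml; apply/andP; split; lra.
  - by rewrite /a ler_norml; apply/andP; split; lra.
  - exact: F_bnd.
  - by apply: F_bnd => j; exact: m_cube.
have step3 : \sum_i a i * (f i - g i) <= L * (n * sqdist t x).
  apply: (@le_trans _ _ (\sum_i `|a i| * (L * \sum_j `|a j|))).
    apply: ler_sum => i _; apply: le_trans (ler_norm _) _; rewrite normrM.
    by apply: ler_wpM2l => //; apply: F_lip => // j; exact: m_cube.
  under eq_bigr do rewrite mulrCA.
  by rewrite -big_distrr/= ler_wpM2l// sum_abs_sqr_le.
have step3h : 2 * h * (\sum_i a i * (f i - g i)) <= 2 * h * (L * (n * sqdist t x)).
  by rewrite ler_wpM2l// mulr_ge0// ltW.
have step4 : h ^+ 2 * (n * c0) <= eta / 2 * h.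
  by rewrite expr2 -mulrA mulrC ler_wpM2r// ltW.
rewrite -/C /C -/n.
have -> : (1 + 2 * L * n * h) * sqdist t x + (delta + eta) * h =
  sqdist t x + 2 * h * (L * (n * sqdist t x)) + delta * h + eta / 2 * h + eta / 2 * h.
  by field.
by rewrite lerD2r; apply: (le_trans step2); rewrite -!addrA lerD2l lerD// lerD2l.
Unshelve. all: by end_near. Qed.

Hypothesis b_ge0 : 0 <= b.

Lemma path_cvg_right t i : 0 <= t -> m u i @[u --> t^'+] --> m t i.
Proof.
move=> t0.
have M0 : 0 <= M.
  have := le_trans (normr_ge0 _) (m_quad i (lexx 0) ler01).
  by rewrite expr1n mulr1.
have bM0 : 0 <= b + M by exact: addr_ge0.
apply/cvgrPdist_le => e e0; apply/nbhs_right0P; near=> s.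
have s0 : 0 <= s by near: s; exact: nbhs_right_ge.
have s1 : s <= 1 by near: s; exact: nbhs_right_le.
rewrite distrC; apply: le_trans (path_lipschitz M0 F_bnd m_cube m_quad i t0 _) _.
  by rewrite s0.
have : s <= e / (b + M + 1).
  by near: s; apply: nbhs_right_le; rewrite divr_gt0// ltr_pwDr// addr_ge0.
by rewrite ler_pdivlMr ?ltr_pwDr// mulrDr mulr1; lra.
Unshelve. all: by end_near. Qed.

Lemma sqdist_cvg_right t x : 0 <= t -> sqdist u x @[u --> t^'+] --> sqdist t x.
Proof.
move=> t0; apply: cvg_big => [|i _]; first exact: add_continuous.
have qm : q x i - m u i @[u --> t^'+] --> q x i - m t i.
  by apply: cvgB; [exact: cvg_cst|exact: path_cvg_right].
by under eq_fun do rewrite expr2; rewrite expr2; exact: cvgM.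
Qed.

Context {dO : measure_display} {Omega : measurableType dO}.
Variables (P : probability Omega R) (X : R -> Omega -> S).
Hypothesis X_meas : forall t s, 0 <= t -> measurable [set w | X t w = s].
Hypothesis X_right : forall w t, 0 <= t -> \forall u \near t^'+, X u w = X t w.
Hypothesis X_fdd : forall (n : nat) (t : nat -> R) (s : nat -> S),
  0 <= t 0%N -> {homo t : i j / (i <= j)%N >-> i <= j} ->
  P [set w | forall i, (i <= n.+1)%N -> X (t i) w = s i] =
  (P [set w | forall i, (i <= n)%N -> X (t i) w = s i] *
   (p (t n.+1 - t n) (s n) (s n.+1))%:E)%E.

(* [exp (- C t) * sqdist t (X t) + (delta + eta) * (T - t)] is a supermartingale
   along every fine enough grid. *)
Lemma sup_sqdist_bound (T lam : R) : 0 < T -> 0 < lam -> 0 <= delta ->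
  lam * expR (- (C * T)) *
    fine (P (some_time X T (fun t x => lam < sqdist t x))) <=
  \sum_x fine (P [set w | X 0 w = x]) * sqdist 0 x + delta * T.
Proof.
move=> T0 lam0 delta0.
have [p0 p1 _ _] := p_trans.
have C0 : 0 <= C by rewrite !mulr_ge0.
pose bad t x := lam < sqdist t x.
have bad_right t x : 0 <= t -> bad t x -> \forall u \near t^'+, bad u x.
  by move=> t0 bt; apply: (cvgr_gt (sqdist t x)) => //; exact: sqdist_cvg_right.
(* A lower bound for the supermartingale at any bad state up to time T, where the squared distance
   exceeds [lam]. *)
pose c := lam * expR (- (C * T)).
have c0 : 0 < c by rewrite mulr_gt0// expR_gt0.
pose E0 := \sum_x fine (P [set w | X 0 w = x]) * sqdist 0 x.
(* The chain being fixed, the rate error can be taken arbitrarily small and disappears from the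
   bound. *)
suff H eta : 0 < eta ->
    c * fine (P (some_time X T bad)) <= E0 + (delta + eta) * T.
  apply/ler_addgt0Pr => e e0.
  have -> : E0 + delta * T + e = E0 + (delta + e / T) * T.
    by rewrite [in RHS]mulrDl divfK ?gt_eqF// addrA.
  by apply: H; rewrite divr_gt0.
move=> eta0; rewrite -ler_pdivlMl//; apply: some_time_le => //.
have [rho /= rho0 stepP] := sqdist_step eta0.
near=> n.
pose h := T / 2 ^+ n.
have h0 : 0 < h by rewrite divr_gt0// exprn_gt0.
have hrho : T / 2 ^+ n < rho.
  by near: n; apply: (cvgr_lt 0) => //; exact: cvg_half_pow.
have hstep t x : 0 <= t -> \sum_y p h x y * sqdist (t + h) y <=
    (1 + C * h) * sqdist t x + (delta + eta) * h.
  by apply: stepP => //; rewrite /= sub0r normrN gtr0_norm.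
pose tk := grid_time T n.
have tk0 k : 0 <= tk k by exact: grid_time_ge0.
have tkS k : tk k.+1 = tk k + h by rewrite /tk /grid_time -natr1 mulrDl mul1r.
have tkT k : (k <= 2 ^ n)%N -> tk k <= T by rewrite (grid_time_le T0).
have tk_homo : {homo tk : i j / (i <= j)%N >-> i <= j}.
  by move=> i j ij; rewrite ler_wpM2r ?(ltW h0)// ler_nat.
pose G k x := expR (- (C * tk k)) * sqdist (tk k) x + (delta + eta) * (T - tk k).
rewrite ler_pdivlMl//.
have de0 : 0 <= delta + eta by rewrite addr_ge0// ltW.
have -> : some_grid_time X T bad n =
    ~` avoid (fun k => X (tk k)) (fun k x => bad (tk k) x) (2 ^ n).
  apply/seteqP; split => [w [k kn bk] /= /(_ k kn)|w].
    by rewrite bk.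
  move=> /existsNP[k /not_implyP[kn /negP]]; rewrite negbK => bk.
  by exists k.
have := @maximal_inequality _ _ _ P _ (fun k => X (tk k)) (p h) _ _ _ _
  (fun k x => bad (tk k) x) (2 ^ n) G c.
have -> : \sum_x fine (P [set w | X (tk 0%N) w = x]) * G 0%N x =
    E0 + (delta + eta) * T.
  have tk00 : tk 0%N = 0 by rewrite /tk /grid_time mul0r.
  rewrite /G tk00 mulr0 oppr0 expR0 addr0.
  under eq_bigr do rewrite mul1r mulrDr.
  rewrite big_split/= -big_distrl/=.
  have := fine_partition P (fun s => X_meas s (lexx 0)) measurableT.
  rewrite probability_setT /= => sum1.
  suff -> : \sum_i fine (P [set w | X 0 w = i]) = 1 by rewrite mul1r.
  by rewrite sum1; apply: eq_bigr => x _; rewrite setTI.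
apply.
- by move=> k s; exact: X_meas.
- by move=> x y; apply: p0; exact: ltW.
- by move=> x; apply: p1; exact: ltW.
- by move=> k s; rewrite X_fdd// tkS addrC addKr.
- move=> k x kn; rewrite addr_ge0//; first by rewrite mulr_ge0 ?expR_ge0 ?sqdist_ge0.
  by rewrite mulr_ge0// subr_ge0 tkT.
- move=> k x kn bk; rewrite /c mulrC; apply: ler_wpDr.
    by rewrite mulr_ge0// subr_ge0 tkT.
  apply: ler_pM; rewrite ?expR_ge0 ?(ltW lam0) ?(ltW bk)//.
  by rewrite ler_expR lerN2 ler_wpM2l// tkT.
- move=> k x kn; rewrite /G.
  under eq_bigr do rewrite mulrDr mulrCA.
  rewrite big_split/= -big_distrr/= -big_distrl/= p1 ?(ltW h0)// mul1r.
  have e1 : expR (- (C * tk k.+1)) * (\sum_y p h x y * sqdist (tk k.+1) y) <=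
      expR (- (C * tk k.+1)) * ((1 + C * h) * sqdist (tk k) x + (delta + eta) * h).
    by rewrite tkS ler_wpM2l ?expR_ge0// hstep.
  (* The exponential discount absorbs the growth factor of one step, since 1 + C h <= exp(C h). *)
  have e2 : expR (- (C * tk k.+1)) * (1 + C * h) <= expR (- (C * tk k)).
    apply: (@le_trans _ _ (expR (- (C * tk k.+1)) * expR (C * h))).
      by rewrite ler_wpM2l ?expR_ge0// expR_ge1Dx.
    by rewrite -expRD tkS ler_expR; lra.
  have e3 : expR (- (C * tk k.+1)) <= 1.
    by rewrite -expR0 ler_expR oppr_le0 mulr_ge0.
  have e4 := ler_wpM2r (sqdist_ge0 (tk k) x) e2.
  have e5 : expR (- (C * tk k.+1)) * ((delta + eta) * h) <= 1 * ((delta + eta) * h).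
    by rewrite ler_wpM2r// mulr_ge0// ltW.
  move: e1 e4 e5; rewrite tkS; lra.
Unshelve. all: by end_near. Qed.

End DensityDependentChain.

(** * Mean-field drift *)

Section MeanField.
Variables (R : realType) (K : nat) (C : finType) (adj : rel C).
Variables (W : 'I_K -> 'I_K -> R) (beta : R) (E : rel 'I_K).

(** The weight [a] is a parameter so that the same formula serves the limiting weights and the class
    frequencies at finite N. *)
Definition mf_potential (a : C -> R) (c : C) (z z' : 'I_K)
    (q : C * 'I_K -> R) : R :=
  beta * \sum_x (W x z' - W x z) * \sum_(c' | adj c c') a c' * q (c', x).

Definition mf_rate (a : C -> R) (c : C) (z z' : 'I_K) (q : C * 'I_K -> R) : R :=
  expR (- Num.max (mf_potential a c z z' q) 0) * (E z z')%:R.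

(** Inflow minus outflow. The terms with [w] equal to [i.2] cancel between the two sums, so no
    diagonal convention is needed. *)
Definition mf_drift (a : C -> R) (q : C * 'I_K -> R) (i : C * 'I_K) : R :=
  \sum_w q (i.1, w) * mf_rate a i.1 w i.2 q - q i * \sum_w mf_rate a i.1 i.2 w q.

Definition W_bound : R := \sum_x \sum_y `|W x y|.

Lemma W_bound_ge0 : 0 <= W_bound.
Proof. by apply: sumr_ge0 => x _; apply: sumr_ge0. Qed.

Lemma W_le x y : `|W x y| <= W_bound.
Proof.
apply: le_trans (@term_le_sum _ _ (fun y => `|W x y|) y _) _ => //.
by apply: (@term_le_sum _ _ (fun x => \sum_y `|W x y|)) => z; apply: sumr_ge0.
Qed.

(** Both arguments vary because two uses are made of it: equal weights give the Lipschitz bound in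
    [q], equal measures give the cost of replacing frequencies by their limits. *)
Lemma mf_potential_diff a a' c z z' q q' :
  `|mf_potential a c z z' q - mf_potential a' c z z' q'| <=
  `|beta| * (2 * W_bound) * \sum_i `|a i.1 * q i - a' i.1 * q' i|.
Proof.
rewrite /mf_potential -mulrBr normrM -mulrA ler_wpM2l// -sumrB.
apply: (le_trans (ler_norm_sum _ _ _)).
have -> : \sum_(i : C * 'I_K) `|a i.1 * q i - a' i.1 * q' i| =
    \sum_x \sum_c' `|a c' * q (c', x) - a' c' * q' (c', x)|.
  by rewrite exchange_big pair_bigA/=; apply: eq_bigr => -[].
rewrite big_distrr/=; apply: ler_sum => x _.
rewrite -mulrBr normrM; apply: ler_pM => //.
  have := W_le x z'; have := W_le x z; have := ler_normB (W x z') (W x z); lra.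
rewrite -sumrB (le_trans (ler_norm_sum _ _ _))//.
by rewrite big_mkcond/=; apply: ler_sum => c' _; case: ifP.
Qed.

Lemma mf_rate_itv a c z z' q : 0 <= mf_rate a c z z' q <= 1.
Proof.
have /andP[? ?] := expR_max_itv (mf_potential a c z z' q).
have /andP[? ?] := @bool_itv01 R (E z z').
by rewrite mulr_ge0//= mulr_ile1.
Qed.

Lemma mf_rate_diff a c z z' q q' :
  `|mf_rate a c z z' q - mf_rate a c z z' q'| <=
  `|mf_potential a c z z' q - mf_potential a c z z' q'|.
Proof.
rewrite -mulrBl normrM -[leRHS]mulr1; apply: ler_pM => //.
  exact: expR_max_lipschitz.
by case: (E z z'); rewrite ?normr1 ?normr0.
Qed.

Section Drift.
Variable a : C -> R.

Definition rate_lip : R := `|beta| * (2 * W_bound) * \sum_c `|a c|.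
(** The inflow contributes 1 + K [rate_lip], its measures adding up to one l1 distance at most; the
    outflow contributes K + K [rate_lip], the same coordinate being repeated K times. *)
Definition drift_lip : R := 1 + K%:R + 2 * K%:R * rate_lip.

Lemma rate_lip_ge0 : 0 <= rate_lip.
Proof. by rewrite !mulr_ge0 ?W_bound_ge0// sumr_ge0. Qed.

Lemma drift_lip_ge0 : 0 <= drift_lip.
Proof.
apply: addr_ge0; first exact: addr_ge0.
by apply: mulr_ge0 rate_lip_ge0; exact: mulr_ge0.
Qed.

Lemma mf_rate_lipschitz c z z' q q' :
  `|mf_rate a c z z' q - mf_rate a c z z' q'| <=
  rate_lip * \sum_i `|q i - q' i|.
Proof.
apply: le_trans (mf_rate_diff _ _ _ _ _ _) _.
apply: (le_trans (mf_potential_diff _ _ _ _ _ _ _)).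
rewrite /rate_lip -[leRHS]mulrA ler_wpM2l ?mulr_ge0 ?W_bound_ge0//.
rewrite big_distrr/=; apply: ler_sum => i _; rewrite -mulrBr normrM ler_wpM2r//.
exact: (@term_le_sum _ _ (fun c => `|a c|)).
Qed.

Let sum_le_K (f : 'I_K -> R) e : (forall w, f w <= e) -> \sum_w f w <= K%:R * e.
Proof.
move=> fe; rewrite -[X in X%:R]card_ord mulr_natl -sumr_const.
exact: ler_sum.
Qed.

Lemma mf_drift_lipschitz q q' i :
  (forall j, 0 <= q j <= 1) -> (forall j, 0 <= q' j <= 1) ->
  `|mf_drift a q i - mf_drift a q' i| <= drift_lip * \sum_j `|q j - q' j|.
Proof.
move=> q01 q'01; set s := \sum_j _.
have s0 : 0 <= s by exact: sumr_ge0.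
have prod_diff (u v x y : R) : 0 <= u <= 1 -> 0 <= y <= 1 ->
    `|u * x - v * y| <= `|u - v| + `|x - y|.
  move=> /andP[u0 u1] /andP[y0 y1].
  have -> : u * x - v * y = (u - v) * y + u * (x - y) by ring.
  rewrite (le_trans (ler_normD _ _))// !normrM (ger0_norm u0) (ger0_norm y0).
  by rewrite lerD// ?ler_piMr// ler_piMl.
have rl c z z' := mf_rate_lipschitz c z z' q q'.
rewrite -/s in rl.
have t1 : `|\sum_w q (i.1, w) * mf_rate a i.1 w i.2 q -
    \sum_w q' (i.1, w) * mf_rate a i.1 w i.2 q'| <= s + K%:R * (rate_lip * s).
  rewrite -sumrB (le_trans (ler_norm_sum _ _ _))//.
  apply: (@le_trans _ _ (\sum_w (`|q (i.1, w) - q' (i.1, w)| + rate_lip * s))).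
    apply: ler_sum => w _; apply: le_trans (prod_diff _ _ _ _ _ _) _ => //.
      exact: mf_rate_itv.
    by rewrite lerD2l.
  rewrite big_split/= lerD//; last exact: sum_le_K.
  rewrite /s (_ : \sum_j _ = \sum_c \sum_w `|q (c, w) - q' (c, w)|); last first.
    by rewrite pair_bigA/=; apply: eq_bigr => -[].
  apply: (@term_le_sum _ _ (fun c => \sum_w `|q (c, w) - q' (c, w)|)) => c.
  exact: sumr_ge0.
have t2 : `|q i * (\sum_w mf_rate a i.1 i.2 w q) -
    q' i * (\sum_w mf_rate a i.1 i.2 w q')| <= K%:R * (s + rate_lip * s).
  rewrite [q i * _]big_distrr [q' i * _]big_distrr/= -sumrB.
  apply: le_trans (ler_norm_sum _ _ _) _.
  apply: sum_le_K => w; apply: le_trans (prod_diff _ _ _ _ _ _) _ => //.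
    exact: mf_rate_itv.
  apply: lerD; last exact: rl.
  by rewrite /s; exact: (@term_le_sum _ _ (fun j => `|q j - q' j|)).
rewrite /mf_drift /drift_lip; set x1 := \sum_w _ in t1 *.
set y1 := \sum_w _ in t1 *; set x2 := q i * _ in t2 *; set y2 := q' i * _ in t2 *.
have -> : x1 - x2 - (y1 - y2) = (x1 - y1) - (x2 - y2) by ring.
by rewrite (le_trans (ler_normB _ _))//; lra.
Qed.

Lemma mf_drift_bounded q i : (forall j, 0 <= q j <= 1) ->
  `|mf_drift a q i| <= K%:R.
Proof.
move=> q01.
have prod01 (u v : R) : 0 <= u <= 1 -> 0 <= v <= 1 -> 0 <= u * v <= 1.
  by move=> /andP[? ?] /andP[? ?]; rewrite mulr_ge0//= mulr_ile1.
rewrite /mf_drift big_distrr/=; set x := \sum_w _; set y := \sum_w _.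
have [x0 xK] : 0 <= x /\ x <= K%:R.
  split.
    apply: sumr_ge0 => w _.
    by have /andP[] := prod01 _ _ (q01 (i.1, w)) (mf_rate_itv a i.1 w i.2 q).
  rewrite -[K%:R]mulr1; apply: sum_le_K => w.
  by have /andP[] := prod01 _ _ (q01 (i.1, w)) (mf_rate_itv a i.1 w i.2 q).
have [y0 yK] : 0 <= y /\ y <= K%:R.
  split.
    apply: sumr_ge0 => w _.
    by have /andP[] := prod01 _ _ (q01 i) (mf_rate_itv a i.1 i.2 w q).
  rewrite -[K%:R]mulr1; apply: sum_le_K => w.
  by have /andP[] := prod01 _ _ (q01 i) (mf_rate_itv a i.1 i.2 w q).
by rewrite ler_norml; apply/andP; split; lra.
Qed.

Definition simplexes : set (C * 'I_K -> R) :=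
  [set q | (forall i, 0 <= q i) /\ (forall c, \sum_z q (c, z) = 1)].

Lemma simplexes_cube q : simplexes q -> forall i, 0 <= q i <= 1.
Proof.
move=> [q0 q1] [c z]; rewrite q0/= -(q1 c).
by apply: (@term_le_sum _ _ (fun z => q (c, z))).
Qed.

(** The outflow rate from a state is at most K, so a step of length at most 1/(K + 1) cannot remove
    more mass than is present; inflow and outflow have the same total over a class, which conserves
    its mass. *)
Lemma simplexes_step q h : simplexes q -> 0 <= h <= K.+1%:R^-1 ->
  simplexes (fun i => q i + h * mf_drift a q i).
Proof.
move=> [q0 q1] /andP[h0 hK]; split => [i|c].
  have in0 : 0 <= \sum_w q (i.1, w) * mf_rate a i.1 w i.2 q.
    apply: sumr_ge0 => w _; rewrite mulr_ge0//.
    by have /andP[] := mf_rate_itv a i.1 w i.2 q.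
  have outK : h * \sum_w mf_rate a i.1 i.2 w q <= 1.
    apply: (@le_trans _ _ (K.+1%:R^-1 * K.+1%:R)); last by rewrite mulVf.
    apply: ler_pM => //.
      by apply: sumr_ge0 => w _; have /andP[] := mf_rate_itv a i.1 i.2 w q.
    apply: (@le_trans _ _ (K%:R * 1)); last by rewrite mulr1 ler_nat.
    by apply: sum_le_K => w; have /andP[] := mf_rate_itv a i.1 i.2 w q.
  rewrite /mf_drift mulrBr.
  have := mulr_ge0 h0 in0; have := ler_wpM2l (q0 i) outK.
  by rewrite mulr1 (mulrCA (q i)); lra.
rewrite big_split/= q1 -big_distrr/= /mf_drift sumrB/= exchange_big/=.
rewrite [X in _ - X](eq_bigr (fun z => \sum_w q (c, z) * mf_rate a c z w q)).
  by rewrite subrr mulr0 addr0.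
by move=> z _; rewrite big_distrr.
Qed.

Lemma simplexes_closed (u : nat -> C * 'I_K -> R) v :
  (forall n, simplexes (u n)) ->
  (forall i, u n i @[n --> \oo] --> v i) -> simplexes v.
Proof.
move=> Du uv; split => [i|c].
  by apply: (cvgr_to_ge (uv i)); apply: nearW => n; have [] := Du n.
have : \sum_z u n (c, z) @[n --> \oo] --> \sum_z v (c, z).
  by apply: cvg_big => [|z _]; [exact: add_continuous|exact: uv].
have -> : (fun n => \sum_z u n (c, z)) = cst 1.
  by apply/funext => n; have [_ ->] := Du n.
by move=> /cvg_lim <- //; apply: cvg_lim => //; exact: cvg_cst.
Qed.

End Drift.
End MeanField.

(** * Metropolis dynamics *)

Section ParticleSystem.
Variables (R : realType) (K : nat) (C : finType) (adj : rel C).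
Variables (W : 'I_K -> 'I_K -> R) (beta : R) (E : rel 'I_K).
Variables (N : nat) (cls : 'I_N -> C).
Hypothesis adj_sym : symmetric adj.
Hypothesis W_sym : forall z z', W z z' = W z' z.
Hypothesis E_irr : irreflexive E.
Local Notation conf := {ffun 'I_N -> 'I_K}.

Definition upd (x : conf) (l : 'I_N) (z : 'I_K) : conf :=
  [ffun k => if k == l then z else x k].

(** An admissible [y] arises from exactly one pair (l, z): the site where it differs from [x] and
    its value there. Irreflexivity of [E] ensures that an allowed update really changes the site.
    Sums over configurations thus become sums over single flips. *)
Lemma admissible_upd (x y : conf) :
  (admissible E x y)%:R =
  \sum_l \sum_z (E (x l) z && (upd x l z == y))%:R :> R.
Proof.
have updP l z : E (x l) z -> upd x l z = y ->
    (forall k, (x k != y k) = (k == l)) /\ z = y l.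
  move=> Exz <-; split => [k|]; last by rewrite ffunE eqxx.
  rewrite ffunE; case: (eqVneq k l) => [->|]; last by rewrite eqxx.
  by apply/eqP => xz; rewrite xz E_irr in Exz.
case: (boolP (admissible E x y)) => [/existsP[l /andP[/eqP dl Exy]]|nadm].
  have dxy k : (x k != y k) = (k == l).
    by have /setP/(_ k) := dl; rewrite !inE.
  have uE : upd x l (y l) = y.
    apply/ffunP => k; rewrite ffunE; case: (eqVneq k l) => [->//|kl].
    by apply/eqP; rewrite -[_ == _]negbK dxy (negbTE kl).
  rewrite (bigD1 l)//= (bigD1 (y l))//= Exy uE eqxx/= !big1 ?addr0//.
    move=> l' l'l; rewrite big1// => z _.
    case: (boolP (_ && _)) => // /andP[/updP H /eqP/H[H' _]].
    by have := H' l; rewrite dxy eqxx eq_sym (negbTE l'l).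
  move=> z zy; case: (boolP (_ && _)) => // /andP[/updP H /eqP/H[_ zE]].
  by rewrite zE eqxx in zy.
rewrite big1// => l _; rewrite big1// => z _.
case: (boolP (_ && _)) => // /andP[Exz /eqP uE].
have [H zE] := updP _ _ Exz uE.
move/negP: nadm; case; apply/existsP; exists l; rewrite -zE Exz andbT.
by apply/eqP/setP => k; rewrite !inE H.
Qed.

Lemma sum_admissible (x : conf) (g : conf -> R) :
  \sum_y (admissible E x y)%:R * g y =
  \sum_l \sum_z (E (x l) z)%:R * g (upd x l z).
Proof.
under eq_bigr do rewrite admissible_upd big_distrl/=.
rewrite exchange_big/=; apply: eq_bigr => l _.
under eq_bigr do rewrite big_distrl/=.
rewrite exchange_big/=; apply: eq_bigr => z _.
rewrite (bigD1 (upd x l z))//= eqxx andbT big1 ?addr0// => y yu.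
by rewrite [_ == y]eq_sym (negbTE yu) andbF mul0r.
Qed.

Definition class_size (c : C) : nat := #|[set l | cls l == c]%SET|.

Definition emp (x : conf) (i : C * 'I_K) : R :=
  (\sum_(l | cls l == i.1) (x l == i.2)%:R) / (class_size i.1)%:R.

Lemma sum_class_size c (e : R) : \sum_(l | cls l == c) e = (class_size c)%:R * e.
Proof.
rewrite sumr_const -[LHS]mulr_natl; congr (_%:R * _).
by apply: eq_card => l; rewrite !inE.
Qed.

Lemma emp_cube x i : 0 <= emp x i <= 1.
Proof.
rewrite /emp divr_ge0 ?sumr_ge0//=.
have [->|n0] := eqVneq (class_size i.1) 0%N; first by rewrite invr0 mulr0.
rewrite ler_pdivrMr ?ltr0n ?lt0n// mul1r -[leRHS]mulr1 -sum_class_size.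
by apply: ler_sum => l _; case: (_ == _).
Qed.

Lemma sum_indicator (f : 'I_K -> R) z : \sum_w (z == w)%:R * f w = f z.
Proof.
rewrite (bigD1 z)//= eqxx mul1r big1 ?addr0// => w wz.
by rewrite eq_sym (negbTE wz) mul0r.
Qed.

Lemma emp_sum x c (f : 'I_K -> R) :
  \sum_w emp x (c, w) * f w = (\sum_(l | cls l == c) f (x l)) / (class_size c)%:R.
Proof.
rewrite /emp/=; under eq_bigr do rewrite mulrAC big_distrl/=.
rewrite -big_distrl/= exchange_big/=; congr (_ / _); apply: eq_bigr => l _.
exact: sum_indicator.
Qed.

(** Multiplying by the class size, instead of dividing, keeps the identity usable for empty classes,
    where both sides are 0. *)
Lemma emp_sum_size x c (f : 'I_K -> R) :
  (class_size c)%:R * (\sum_w emp x (c, w) * f w) = \sum_(l | cls l == c) f (x l).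
Proof.
rewrite emp_sum; have [c0|n0] := eqVneq (class_size c) 0%N.
  rewrite c0 mul0r big_pred0// => l; apply/negbTE/negP => lc.
  by move/eqP: c0; rewrite cards_eq0 => /eqP/setP/(_ l); rewrite !inE lc.
by rewrite mulrCA divff ?mulr1// pnatr_eq0.
Qed.

Lemma emp_upd x l z i : emp (upd x l z) i - emp x i =
  (cls l == i.1)%:R * ((z == i.2)%:R - (x l == i.2)%:R) / (class_size i.1)%:R.
Proof.
rewrite /emp -mulrBl; congr (_ / _); rewrite -sumrB.
have off k : k != l -> (upd x l z k == i.2)%:R - (x k == i.2)%:R = 0 :> R.
  by move=> kl; rewrite ffunE (negbTE kl) subrr.
have [li|li] := eqVneq (cls l) i.1.
  rewrite (bigD1 l) ?li ?eqxx//= big1 => [|k /andP[_ /off->//]].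
  by rewrite addr0 ffunE eqxx mul1r.
rewrite mul0r big1// => k ki; rewrite off//.
by apply: contraNneq li => <-.
Qed.

Definition pair_energy (x : conf) : R :=
  beta / (2 * N%:R) * \sum_l \sum_(k | adj (cls l) (cls k)) W (x l) (x k).

(** Only the row and the column through [l] are affected by a flip at [l]; twice the row counts the
    diagonal entry once too often. *)
Lemma sym_sum_split (f : 'I_N -> 'I_N -> R) l : (forall i k, f i k = f k i) ->
  \sum_i \sum_k f i k =
  \sum_(i | i != l) \sum_(k | k != l) f i k + 2 * (\sum_k f l k) - f l l.
Proof.
move=> fsym; rewrite (bigD1 l)//=.
under [X in _ + X]eq_bigr do rewrite (bigD1 l)//=.
rewrite big_split/=.
have -> : \sum_(i | i != l) f i l = \sum_(k | k != l) f l k.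
  by apply: eq_bigr => i _; rewrite fsym.
by rewrite !(bigD1 l isT)/=; ring.
Qed.

Definition class_freq (c : C) : R := (class_size c)%:R / N%:R.

(** By symmetry the row and column of [l] contribute equally, which cancels the 1/2 in the energy.
    The remainder is the self-interaction of [l]: the empirical measure counts [l] at its old state,
    while after the flip it interacts with itself at [z]. *)
Lemma pair_energy_upd x l z :
  pair_energy (upd x l z) - pair_energy x =
  mf_potential adj W beta class_freq (cls l) (x l) z (emp x) +
  beta / (2 * N%:R) *
    ((adj (cls l) (cls l))%:R * (W z z + W (x l) (x l) - 2 * W z (x l))).
Proof.
pose f (y : conf) i k := (adj (cls i) (cls k))%:R * W (y i) (y k).
have fsym y i k : f y i k = f y k i by rewrite /f adj_sym W_sym.
have eE y : pair_energy y = beta / (2 * N%:R) * \sum_i \sum_k f y i k.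
  congr (_ * _); apply: eq_bigr => i _; rewrite big_mkcond/=.
  by apply: eq_bigr => k _; rewrite /f; case: ifP; rewrite ?mul1r ?mul0r.
have uk k : k != l -> upd x l z k = x k by move=> kl; rewrite ffunE (negbTE kl).
have ul : upd x l z l = z by rewrite ffunE eqxx.
pose g := \sum_k (adj (cls l) (cls k))%:R * (W z (x k) - W (x l) (x k)).
have potE : mf_potential adj W beta class_freq (cls l) (x l) z (emp x) =
    beta / N%:R * g.
  have -> : g = \sum_(c' | adj (cls l) c') \sum_(k | cls k == c')
      (W z (x k) - W (x l) (x k)).
    rewrite /g (eq_bigr (fun k => if adj (cls l) (cls k)
      then W z (x k) - W (x l) (x k) else 0)); last first.
      by move=> k _; case: (adj _ _); rewrite ?mul1r ?mul0r.
    rewrite -big_mkcond/= (partition_big cls (adj (cls l)))//=.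
    apply: eq_bigr => c' ac'; apply: eq_bigl => k.
    by apply: andb_idl => /eqP->.
  rewrite /mf_potential -mulrA; congr (_ * _).
  under eq_bigr do rewrite big_distrr/=.
  rewrite exchange_big/= big_distrr/=; apply: eq_bigr => c' _.
  rewrite -(emp_sum_size x c' (fun w => W z w - W (x l) w)) !big_distrr/=.
  apply: eq_bigr => w _; rewrite /class_freq [W w z]W_sym [W w (x l)]W_sym.
  by ring.
rewrite potE !eE -mulrBr.
rewrite (sym_sum_split l (fsym (upd x l z))) (sym_sum_split l (fsym x)).
have -> : \sum_(i | i != l) \sum_(k | k != l) f (upd x l z) i k =
    \sum_(i | i != l) \sum_(k | k != l) f x i k.
  by apply: eq_bigr => i il; apply: eq_bigr => k kl; rewrite /f !uk.
have -> : \sum_k f (upd x l z) l k = \sum_k f x l k + g +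
    (adj (cls l) (cls l))%:R * (W z z - W z (x l)).
  rewrite /g -big_split/= (bigD1 l)//= [in RHS](bigD1 l)//= /f ul.
  rewrite (eq_bigr (fun k => (adj (cls l) (cls k))%:R * W (x l) (x k) +
     (adj (cls l) (cls k))%:R * (W z (x k) - W (x l) (x k)))); first by ring.
  by move=> k kl; rewrite uk//; ring.
rewrite /f ul.
have N0 : N%:R != 0 :> R by rewrite pnatr_eq0 -lt0n (leq_ltn_trans _ (ltn_ord l)).
by field.
Qed.

Variable a : C -> R.

(** The term 1/N bounds the self-interaction of the flipped node, the other one the replacement of
    class frequencies by the weights [a]. *)
Definition energy_gap : R := `|beta| * (2 * W_bound W) *
  (N%:R^-1 + K%:R * \sum_c `|class_freq c - a c|).

Lemma energy_gap_ge0 : 0 <= energy_gap.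
Proof.
rewrite /energy_gap !mulr_ge0 ?W_bound_ge0// addr_ge0 ?mulr_ge0//.
exact: sumr_ge0.
Qed.

Lemma energy_gapP x l z :
  `|pair_energy (upd x l z) - pair_energy x -
    mf_potential adj W beta a (cls l) (x l) z (emp x)| <= energy_gap.
Proof.
rewrite pair_energy_upd addrAC (le_trans (ler_normD _ _))//.
rewrite /energy_gap [leRHS]mulrDr [leRHS]addrC; apply: lerD; last first.
  rewrite normrM [`|beta / _|]normrM normfV [`|2 * _|]normrM !normr_nat invfM.
  have -> : `|beta| * (2 * W_bound W) / N%:R =
    `|beta| * (2^-1 / N%:R) * (4 * W_bound W).
    by field; rewrite pnatr_eq0 -lt0n (leq_ltn_trans _ (ltn_ord l)).
  rewrite ler_wpM2l ?mulr_ge0//.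
  rewrite normrM -[leRHS]mul1r; apply: ler_pM => //.
    by case: (adj _ _); rewrite ?normr1 ?normr0.
  have := W_le W z z; have := W_le W (x l) (x l); have := W_le W z (x l).
  have := ler_normB (W z z + W (x l) (x l)) (2 * W z (x l)).
  have := ler_normD (W z z) (W (x l) (x l)).
  rewrite normrM (ger0_norm (ler0n _ 2)).
  by move=> *; lra.
apply: (le_trans (mf_potential_diff _ _ _ _ _ _ _ _ _ _)).
rewrite ler_wpM2l ?mulr_ge0 ?W_bound_ge0//.
have -> : \sum_(i : C * 'I_K) `|class_freq i.1 * emp x i - a i.1 * emp x i| =
    \sum_c \sum_z `|class_freq c * emp x (c, z) - a c * emp x (c, z)|.
  by rewrite pair_bigA/=; apply: eq_bigr => -[].
rewrite big_distrr/=; apply: ler_sum => c _.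
rewrite -[X in X%:R]card_ord mulr_natl -sumr_const; apply: ler_sum => w _.
have /andP[e0 e1] := emp_cube x (c, w).
by rewrite -mulrBl normrM (ger0_norm e0) ler_piMr.
Qed.

Definition metropolis_rate (x y : conf) : R :=
  expR (- Num.max (pair_energy y - pair_energy x) 0) * (admissible E x y)%:R.

Lemma sum_metropolis_rate x (g : conf -> R) :
  \sum_y metropolis_rate x y * g y =
  \sum_l \sum_z (E (x l) z)%:R *
    (expR (- Num.max (pair_energy (upd x l z) - pair_energy x) 0) * g (upd x l z)).
Proof.
pose h y := expR (- Num.max (pair_energy y - pair_energy x) 0) * g y.
rewrite -(sum_admissible x h); apply: eq_bigr => y _.
by rewrite /metropolis_rate /h; ring.
Qed.

Let sum_le_K (f : 'I_K -> R) e : (forall w, f w <= e) -> \sum_w f w <= K%:R * e.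
Proof.
move=> fe; rewrite -[X in X%:R]card_ord mulr_natl -sumr_const.
exact: ler_sum.
Qed.

Let sum_drop_diag (x : conf) (psi : conf -> R) (g : conf -> R) : g x = 0 ->
  \sum_(y | y != x) psi y * g y = \sum_y psi y * g y.
Proof. by move=> gx; rewrite [RHS](bigD1 x)//= gx mulr0 add0r. Qed.

Let sum_class (c : C) (g : 'I_N -> R) :
  \sum_l (cls l == c)%:R * g l = \sum_(l | cls l == c) g l.
Proof.
rewrite [RHS]big_mkcond/=; apply: eq_bigr => l _.
by case: (_ == _); rewrite ?mul1r ?mul0r.
Qed.

Let div_class_size c (e : R) : 0 <= e ->
  (class_size c)%:R * e / (class_size c)%:R <= e.
Proof.
move=> e0; have [->|n0] := eqVneq (class_size c) 0%N; first by rewrite mul0r mul0r.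
by rewrite mulrAC divff ?mul1r// pnatr_eq0.
Qed.

(** At an empirical vector the limiting drift is an average over the nodes of a class, so it can be
    compared with the generator node by node. *)
Lemma mf_drift_emp x i : mf_drift adj W beta E a (emp x) i =
  (\sum_(l | cls l == i.1) \sum_z mf_rate adj W beta E a i.1 (x l) z (emp x) *
    ((z == i.2)%:R - (x l == i.2)%:R)) / (class_size i.1)%:R.
Proof.
rewrite /mf_drift emp_sum /emp mulrAC -mulrBl; congr (_ / _).
rewrite big_distrl/= -sumrB; apply: eq_bigr => l _.
under [RHS]eq_bigr do rewrite mulrBr.
rewrite sumrB; congr (_ - _).
  have := sum_indicator (fun w => mf_rate adj W beta E a i.1 (x l) w (emp x)) i.2.
  by move=> <-; apply: eq_bigr => z _; rewrite mulrC eq_sym.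
rewrite mulrC big_distrl/=; apply: eq_bigr => z _.
by have [->//|] := eqVneq (x l) i.2; rewrite !mulr0.
Qed.

(** Flip by flip, the two rates differ by at most [energy_gap], as the Metropolis factor is
    1-Lipschitz; there are K target states per node, and averaging over the class does not increase
    the error. *)
Lemma metropolis_drift x i :
  `|\sum_(y | y != x) metropolis_rate x y * (emp y i - emp x i) -
    mf_drift adj W beta E a (emp x) i| <= K%:R * energy_gap.
Proof.
rewrite (@sum_drop_diag x _ (fun y => emp y i - emp x i)) ?subrr//.
rewrite sum_metropolis_rate mf_drift_emp.
have -> : \sum_l \sum_z (E (x l) z)%:R *
    (expR (- Num.max (pair_energy (upd x l z) - pair_energy x) 0) *
      (emp (upd x l z) i - emp x i)) =
  (\sum_(l | cls l == i.1) \sum_z (E (x l) z)%:R *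
    expR (- Num.max (pair_energy (upd x l z) - pair_energy x) 0) *
    ((z == i.2)%:R - (x l == i.2)%:R)) / (class_size i.1)%:R.
  rewrite -sum_class big_distrl/=; apply: eq_bigr => l _.
  rewrite !big_distrr/= big_distrl/=; apply: eq_bigr => z _.
  by rewrite emp_upd; ring.
rewrite -mulrBl -sumrB normrM normfV (ger0_norm (ler0n _ _)).
have gK0 : 0 <= K%:R * energy_gap by rewrite mulr_ge0 ?energy_gap_ge0.
apply: le_trans (div_class_size i.1 gK0); rewrite ler_wpM2r//.
rewrite -sum_class_size (le_trans (ler_norm_sum _ _ _))//.
apply: ler_sum => l /eqP li; rewrite -sumrB (le_trans (ler_norm_sum _ _ _))//.
apply: sum_le_K => z; rewrite -mulrBl normrM -[leRHS]mulr1.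
apply: ler_pM => //; last first.
  by case: (z == _); case: (x l == _);
    rewrite ?subrr ?subr0 ?sub0r ?normrN ?normr1 ?normr0.
rewrite /mf_rate [X in X - _]mulrC -mulrBl normrM -[leRHS]mulr1.
apply: ler_pM => //; last by case: (E _ _); rewrite ?normr1 ?normr0.
by apply: le_trans (expR_max_lipschitz _ _) _; rewrite -li energy_gapP.
Qed.

(** A class of size s has s nodes, each with at most K flips of rate at most 1 and squared jump at
    most 1/s^2, hence K/s in total. Summing over all classes makes the bound uniform in [i]. *)
Lemma metropolis_quadratic x i :
  \sum_(y | y != x) metropolis_rate x y * (emp y i - emp x i) ^+ 2 <=
  K%:R * \sum_c (class_size c)%:R^-1.
Proof.
rewrite (@sum_drop_diag x _ (fun y => (emp y i - emp x i) ^+ 2)); last first.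
  by rewrite subrr expr0n.
rewrite sum_metropolis_rate.
apply: (@le_trans _ _ (\sum_l (cls l == i.1)%:R * (K%:R / (class_size i.1)%:R ^+ 2))).
  apply: ler_sum => l _; rewrite mulrCA; apply: sum_le_K => z.
  have /andP[e0 e1] := expR_max_itv (pair_energy (upd x l z) - pair_energy x).
  rewrite emp_upd; have [li|] := eqVneq (cls l) i.1; last first.
    by rewrite !mul0r expr0n !mulr0.
  have s1 : ((z == i.2)%:R - (x l == i.2)%:R) ^+ 2 <= 1 :> R.
    by case: (z == _); case: (x l == _);
      rewrite ?subrr ?subr0 ?sub0r ?sqrrN ?expr1n ?expr0n.
  have es : expR (- Num.max (pair_energy (upd x l z) - pair_energy x) 0) *
      ((z == i.2)%:R - (x l == i.2)%:R) ^+ 2 <= 1.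
    by rewrite mulr_ile1 ?sqr_ge0.
  rewrite !mul1r exprMn -exprVn [X in _ * X]mulrA mulrA ler_piMl ?sqr_ge0//.
  by case: (E _ _); rewrite ?mul1r ?mul0r.
rewrite sum_class sum_class_size.
apply: (@le_trans _ _ (K%:R * (class_size i.1)%:R^-1)).
  have [->|n0] := eqVneq (class_size i.1) 0%N; first by rewrite mul0r invr0 mulr0.
  by rewrite le_eqVlt; apply/orP; left; apply/eqP; field; rewrite pnatr_eq0.
rewrite ler_wpM2l//; apply: (@term_le_sum _ _ (fun c => (class_size c)%:R^-1)) => c.
by rewrite invr_ge0.
Qed.

End ParticleSystem.

(** * Blocks with central and peripheral nodes *)

Section Coordinates.
Variables (R : realType) (r K : nat).
Local Notation I := (((bool * 'I_r) * 'I_K)%type).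
Local Notation MV := (measure_vector R r K).

(* [(true, j)] is the class of central nodes of block [j], [(false, j)] that of
   its peripheral nodes. *)
Definition coord (q : MV) (i : I) : R :=
  if i.1.1 then q.1 i.1.2 i.2 else q.2 i.1.2 i.2.

Definition of_coord (u : I -> R) : MV :=
  (\matrix_(j, z) u ((true, j), z), \matrix_(j, z) u ((false, j), z)).

Lemma of_coordK u i : coord (of_coord u) i = u i.
Proof. by case: i => [[[] j] z]; rewrite /coord/= mxE. Qed.

Lemma coord_inj q q' : (forall i, coord q i = coord q' i) -> q = q'.
Proof.
case: q q' => [q1 q2] [q1' q2'] H; congr (_, _); apply/matrixP => j z.
  exact: (H ((true, j), z)).
exact: (H ((false, j), z)).
Qed.

Lemma coordB q q' i : coord (q - q') i = coord q i - coord q' i.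
Proof. by rewrite /coord; case: ifP => _; rewrite !mxE. Qed.

Lemma mv_norm_le q e : 0 <= e -> (`|q| <= e) <-> (forall i, `|coord q i| <= e).
Proof.
move=> e0; have nE : `|q| = Num.max `|q.1| `|q.2| by [].
have mxE (m : 'M[R]_(r, K)) : (`|m| <= e) <-> (forall j z, `|m j z| <= e).
  rewrite [`|m|]/Num.Def.normr/= mx_normrE; split => [/bigmax_leP[_ H] j z|H].
    exact: (H (j, z)).
  by apply/bigmax_leP; split.
rewrite nE ge_max; split => [/andP[/mxE H1 /mxE H2] [[[] j] z]//|H]; first exact: H1.
  exact: H2.
apply/andP; split; apply/mxE => j z; first exact: (H ((true, j), z)).
exact: (H ((false, j), z)).
Qed.

Lemma coord_cont i : continuous (coord^~ i).
Proof.
case: i => [[[] j] z] q.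
  apply: (@continuous_comp MV 'M[R]_(r, K) R fst (fun m => m j z)).
    exact: cvg_fst.
  exact: coord_continuous.
apply: (@continuous_comp MV 'M[R]_(r, K) R snd (fun m => m j z)).
  exact: cvg_snd.
exact: coord_continuous.
Qed.

Lemma of_coord_continuous (f : R -> I -> R) :
  (forall i, continuous (f^~ i)) -> continuous (fun t => of_coord (f t)).
Proof.
move=> fc t; apply/cvgrPdist_le => e e0.
have : \forall s \near t, forall i, `|f t i - f s i| <= e.
  apply: (@filter_forall R I (fun i s => `|f t i - f s i| <= e) (nbhs t)) => i.
  by have /cvgrPdist_le/(_ e e0) := fc i t.
apply: filterS => s H; apply/(mv_norm_le _ (ltW e0)) => i.
by rewrite coordB !of_coordK.
Qed.

Lemma probability_vectorsP q : probability_vectors q <-> simplexes (coord q).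
Proof.
split => [H|[q0 q1] j].
  by split => [[[[] j] z]|[[] j]]; have [q1 s1 q2 s2] := H j;
    [exact: q1|exact: q2|exact: s1|exact: s2].
split.
- by move=> z; exact: (q0 ((true, j), z)).
- exact: (q1 (true, j)).
- by move=> z; exact: (q0 ((false, j), z)).
- exact: (q1 (false, j)).
Qed.

End Coordinates.

(** Two peripheral classes always interact; once a central class is involved, the blocks must agree.
    In this form the symmetry of the interaction, hidden by the blockwise sums of the energy, is
    plain. *)
Definition class_adj (r : nat) : rel (bool * 'I_r) :=
  fun c c' => (c.1 || c'.1) ==> (c.2 == c'.2).

Lemma class_adj_sym r : symmetric (@class_adj r).
Proof. by move=> c c'; rewrite /class_adj orbC eq_sym. Qed.

Section Translation.
Variables (R : realType) (r K : nat) (alpha pc pp : 'I_r -> R).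
Variables (W : 'I_K -> 'I_K -> R) (beta : R) (E : rel 'I_K).
Hypothesis E_irr : irreflexive E.

Definition class_weight (c : bool * 'I_r) : R :=
  alpha c.2 * (if c.1 then pc c.2 else pp c.2).
Local Notation drift := (mf_drift (@class_adj r) W beta E class_weight).

Lemma sum_classes (f : bool * 'I_r -> R) :
  \sum_c f c = \sum_j f (true, j) + \sum_j f (false, j).
Proof.
rewrite (eq_bigr (fun c => f (c.1, c.2))) => [|[]//].
by rewrite -(pair_bigA _ (fun b j => f (b, j)))/= big_bool.
Qed.

Lemma potential_cE j z z' q : potential_c W beta alpha pc pp j z z' q =
  mf_potential (@class_adj r) W beta class_weight (true, j) z z' (coord q).
Proof.
congr (_ * _); apply: eq_bigr => x _; congr (_ * _).
rewrite [RHS]big_mkcond sum_classes /class_adj/= -!big_mkcond/=.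
by congr (_ + _); rewrite (big_pred1 j)// => k; rewrite eq_sym.
Qed.

Lemma potential_pE j z z' q : potential_p W beta alpha pc pp j z z' q =
  mf_potential (@class_adj r) W beta class_weight (false, j) z z' (coord q).
Proof.
congr (_ * _); apply: eq_bigr => x _; congr (_ * _).
rewrite [RHS]big_mkcond sum_classes /class_adj/=; congr (_ + _).
by rewrite -big_mkcond/= (big_pred1 j)// => k; rewrite eq_sym.
Qed.

Lemma rate_matrix_mul (c : bool * 'I_r) (psi : 'I_K -> 'I_K -> R) (u : 'rV[R]_K)
    (q : (bool * 'I_r) * 'I_K -> R) z :
  (forall w, u 0 w = q (c, w)) ->
  (forall w w',
    psi w w' = mf_potential (@class_adj r) W beta class_weight c w w' q) ->
  (u *m rate_matrix E psi) 0 z = drift q (c, z).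
Proof.
move=> uq psiE; rewrite mxE /mf_drift/=.
have rE w w' : expR (- Num.max (psi w w') 0) * (E w w')%:R =
    mf_rate (@class_adj r) W beta E class_weight c w w' q by rewrite psiE.
have r0 w : mf_rate (@class_adj r) W beta E class_weight c w w q = 0.
  by rewrite /mf_rate E_irr mulr0.
rewrite (bigD1 z)//= [in RHS](bigD1 z)//= r0 mulr0 add0r addrC uq; congr (_ + _).
  apply: eq_bigr => w wz; rewrite uq mxE (negbTE wz).
  by rewrite rE.
rewrite mxE eqxx mulrN; congr (- (_ * _)).
rewrite [RHS](bigD1 z)//= r0 add0r; apply: eq_bigr => w _; exact: rE.
Qed.

Lemma generator_cE j z q :
  (row j q.1 *m generator_c W beta E alpha pc pp j q) 0 z =
  drift (coord q) ((true, j), z).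
Proof.
apply: rate_matrix_mul => [w|w w']; first by rewrite mxE.
exact: potential_cE.
Qed.

Lemma generator_pE j z q :
  (row j q.2 *m generator_p W beta E alpha pc pp j q) 0 z =
  drift (coord q) ((false, j), z).
Proof.
apply: rate_matrix_mul => [w|w w']; first by rewrite mxE.
exact: potential_pE.
Qed.

Variable nu : measure_vector R r K.

Lemma mckean_vlasovP (mu : R -> measure_vector R r K) :
  (forall (t : R) (j : 'I_r), 0 < t ->
    is_derive t (1 : R) (fun s : R => row j (mu s).1)
      (row j (mu t).1 *m generator_c W beta E alpha pc pp j (mu t)) /\
    is_derive t (1 : R) (fun s : R => row j (mu s).2)
      (row j (mu t).2 *m generator_p W beta E alpha pc pp j (mu t))) <->
  (forall (t : R) i, 0 < t ->
    is_derive t (1 : R) (fun s : R => coord (mu s) i) (drift (coord (mu t)) i)).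
Proof.
have rowE1 (j : 'I_r) z :
    (fun s => row j (mu s).1 0 z) = (fun s => coord (mu s) ((true, j), z)).
  by apply/funext => s; rewrite mxE.
have rowE2 (j : 'I_r) z :
    (fun s => row j (mu s).2 0 z) = (fun s => coord (mu s) ((false, j), z)).
  by apply/funext => s; rewrite mxE.
split => [H t [[[] j] z] t0|H t j t0].
- have [/is_derive_rowP/(_ z) + _] := H t j t0.
  by rewrite generator_cE rowE1.
- have [_ /is_derive_rowP/(_ z)] := H t j t0.
  by rewrite generator_pE rowE2.
- split; apply/is_derive_rowP => z.
    by rewrite generator_cE rowE1; exact: H.
  by rewrite generator_pE rowE2; exact: H.
Qed.

Lemma mckean_vlasov_unique mu mu' :
  mckean_vlasov W beta E alpha pc pp nu mu ->
  mckean_vlasov W beta E alpha pc pp nu mu' ->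
  forall t, 0 <= t -> mu' t = mu t.
Proof.
move=> [mu0 mu_prob mu_cont /mckean_vlasovP mu_der].
move=> [mu'0 mu'_prob mu'_cont /mckean_vlasovP mu'_der] t t0.
apply: coord_inj => i.
have cube (m : R -> measure_vector R r K) :
    (forall t, 0 <= t -> probability_vectors (m t)) ->
    forall t i, 0 <= t -> 0 <= coord (m t) i <= 1.
  by move=> mp s k /mp/probability_vectorsP/simplexes_cube; apply.
have cont (m : R -> measure_vector R r K) : {within `[0, +oo[, continuous m} ->
    forall i, {within `[0, +oo[, continuous (fun t : R => coord (m t) i)}.
  by move=> mc k s; exact: (cvg_comp _ _ (mc s) (@coord_cont _ _ _ k (m s))).
apply: (ode_unique (drift_lip_ge0 W beta class_weight)
  (@mf_drift_lipschitz R K _ (@class_adj r) W beta E class_weight)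
  (u := fun t => coord (mu' t)) (v := fun t => coord (mu t))) => //.
- exact: cube.
- exact: cube.
- exact: cont.
- exact: cont.
- by move=> k; rewrite mu0 mu'0.
Qed.

Definition limit_path (t : R) : (bool * 'I_r) * 'I_K -> R :=
  flow drift K.+1%:R^-1 (coord nu) t.

Definition limit_solution (t : R) : measure_vector R r K :=
  of_coord (limit_path (Num.max t 0)).

Hypothesis nu_prob : probability_vectors nu.

Let L := drift_lip W beta class_weight.
Let L_ge0 : 0 <= L. Proof. exact: drift_lip_ge0. Qed.
Let nuD : simplexes (coord nu). Proof. exact/probability_vectorsP. Qed.
Let h0_gt0 : 0 < K.+1%:R^-1 :> R. Proof. by rewrite invr_gt0. Qed.
Let lipD (u v : (bool * 'I_r) * 'I_K -> R) i : simplexes u -> simplexes v ->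
  `|drift u i - drift v i| <= L * \sum_j `|u j - v j|.
Proof.
by move=> Du Dv; apply: mf_drift_lipschitz => j; exact: simplexes_cube.
Qed.
Let bndD (u : (bool * 'I_r) * 'I_K -> R) i : simplexes u -> `|drift u i| <= K%:R.
Proof.
by move=> Du; apply: mf_drift_bounded => j; exact: simplexes_cube.
Qed.

Lemma limit_path_in t : 0 <= t -> simplexes (limit_path t).
Proof.
move=> t0; apply: (flow_in L_ge0 (ler0n R K) h0_gt0 lipD bndD _ _ nuD) => //.
  by move=> u h; exact: simplexes_step.
exact: simplexes_closed.
Qed.

Lemma limit_path_quadratic : exists2 M : R, 0 <= M &
  forall t s i, 0 <= t -> 0 <= s ->
  `|limit_path (t + s) i - limit_path t i - s * drift (limit_path t) i| <= M * s ^+ 2.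
Proof.
exists (L * #|{: (bool * 'I_r) * 'I_K}|%:R * K%:R); first by rewrite !mulr_ge0.
move=> t s i t0 s0; rewrite [leRHS]mulrC.
apply: (flow_quadratic L_ge0 (ler0n R K) h0_gt0 lipD bndD _ _ nuD) => //.
  by move=> u h; exact: simplexes_step.
exact: simplexes_closed.
Qed.

Lemma limit_solution_continuous : continuous limit_solution.
Proof.
have [M M0 quad] := limit_path_quadratic.
apply: of_coord_continuous => i.
apply: (path_continuous (ler0n R K) M0 _ _ quad).
  by move=> u k; exact: mf_drift_bounded.
by move=> t k /limit_path_in/simplexes_cube.
Qed.

Lemma limit_solution_mckean_vlasov :
  mckean_vlasov W beta E alpha pc pp nu limit_solution.
Proof.
have [M M0 quad] := limit_path_quadratic.
have cube t i : 0 <= t -> 0 <= limit_path t i <= 1.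
  by move=> /limit_path_in/simplexes_cube.
have lip := @mf_drift_lipschitz _ _ _ (@class_adj r) W beta E class_weight.
have bnd := @mf_drift_bounded _ _ _ (@class_adj r) W beta E class_weight.
split.
- apply: coord_inj => i; rewrite of_coordK maxxx.
  exact: flow0.
- move=> t t0; apply/probability_vectorsP.
  have [D0 D1] := limit_path_in t0.
  split => [i|c]; first by rewrite of_coordK (max_idPl t0).
  by under eq_bigr do rewrite of_coordK (max_idPl t0).
- by apply: continuous_subspaceT; exact: limit_solution_continuous.
- apply/mckean_vlasovP => t i t0.
  have -> : (fun s => coord (limit_solution s) i) =
      (fun s => limit_path (Num.max s 0) i).
    by apply/funext => s; rewrite of_coordK.
  have -> : coord (limit_solution t) = limit_path t.
    by apply/funext => k; rewrite of_coordK (max_idPl (ltW t0)).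
  exact: (path_derive L_ge0 lip (ler0n R K) M0 bnd cube quad).
Qed.

End Translation.

(** * Energy and empirical measures in terms of node classes *)

Section Configurations.
Variables (R : realType) (r K : nat).
Variables (W : 'I_K -> 'I_K -> R) (beta : R) (E : rel 'I_K).
Variables (N : nat) (blk : 'I_N -> 'I_r) (ctr : 'I_N -> bool).

Definition node_class (l : 'I_N) : bool * 'I_r := (ctr l, blk l).

Lemma energyE x : energy W beta blk ctr x =
  pair_energy (@class_adj r) W beta node_class x.
Proof.
congr (_ * _); rewrite (partition_big blk xpredT)//=; apply: eq_bigr => j _.
rewrite [RHS](bigID ctr)/=; congr (_ + _).
  apply: eq_big => [i|i]; rewrite !inE//= => /andP[/eqP ij ci].
  by apply: eq_bigl => k; rewrite !inE /class_adj/= ci ij eq_sym.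
apply: eq_big => [i|i]; rewrite !inE//= => /andP[/eqP ij /negbTE ci].
apply: eq_bigl => k; rewrite !inE /class_adj/= ci ij/= eq_sym.
case: (boolP (ctr k)) => ck /=; rewrite ?andbT ?andbF/=.
  rewrite (_ : (k \in all_peripheral blk ctr) = false) ?orbF//.
  by apply/negP => /bigcupP[l _]; rewrite !inE ck andbF.
by apply/bigcupP; exists (blk k) => //; rewrite !inE eqxx.
Qed.

Lemma jump_rateE x y : jump_rate W beta E blk ctr x y =
  metropolis_rate (@class_adj r) W beta E node_class x y.
Proof. by rewrite /jump_rate !energyE. Qed.

Lemma central_size j : #|central blk ctr j| = class_size node_class (true, j).
Proof.
apply: eq_card => l; rewrite !inE /node_class -pair_eqE /= /pair_eq/=.
by rewrite andbC eqb_id.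
Qed.

Lemma peripheral_size j : #|peripheral blk ctr j| = class_size node_class (false, j).
Proof.
apply: eq_card => l; rewrite !inE /node_class -pair_eqE /= /pair_eq/=.
by rewrite andbC eqbF_neg.
Qed.

Lemma empirical_measureE (A : {set 'I_N}) (x : {ffun 'I_N -> 'I_K}) z :
  empirical_measure R A x 0 z = (\sum_(i in A) (x i == z)%:R) / #|A|%:R.
Proof.
rewrite mxE mulrC summxE; congr (_ * _); apply: eq_bigr => i _.
by rewrite mxE eqxx/= eq_sym.
Qed.

Lemma coord_empirical_vector (x : {ffun 'I_N -> 'I_K}) i :
  coord (empirical_vector R blk ctr x) i = emp R node_class x i.
Proof.
case: i => [[[] j] z]; rewrite /coord/= mxE empirical_measureE /emp/=.
  rewrite central_size; congr (_ / _); apply: eq_bigl => l.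
  by rewrite !inE /node_class -pair_eqE /= /pair_eq/= andbC eqb_id.
rewrite peripheral_size; congr (_ / _); apply: eq_bigl => l.
by rewrite !inE /node_class -pair_eqE /= /pair_eq/= andbC eqbF_neg.
Qed.

End Configurations.

(** * Limits of the class frequencies *)

Section ClassFrequencies.
Variables (R : realType) (r : nat) (alpha pc pp : 'I_r -> R).
Hypothesis alpha_gt0 : forall j, 0 < alpha j.
Hypothesis pc_gt0 : forall j, 0 < pc j.
Hypothesis pp_gt0 : forall j, 0 < pp j.
Variables (blk : forall N, 'I_N -> 'I_r) (ctr : forall N, 'I_N -> bool).
Arguments blk : clear implicits.
Arguments ctr : clear implicits.
Hypothesis block_lim : forall j,
  #|block (blk N) j|%:R / N%:R @[N --> \oo] --> alpha j.
Hypothesis central_lim : forall j,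
  #|central (blk N) (ctr N) j|%:R / #|block (blk N) j|%:R @[N --> \oo] --> pc j.
Hypothesis peripheral_lim : forall j,
  #|peripheral (blk N) (ctr N) j|%:R / #|block (blk N) j|%:R @[N --> \oo] --> pp j.

Local Notation weight := (class_weight alpha pc pp).
Local Notation freq N := (class_freq R (node_class (blk N) (ctr N))).

Lemma class_freq_cvg c : freq N c @[N --> \oo] --> weight c.
Proof.
(* The condition m <= n keeps the identity true for an empty block, where both sides are 0. *)
have prodE (N m n : nat) : (m <= n)%N ->
    m%:R / N%:R = (n%:R / N%:R) * (m%:R / n%:R) :> R.
  move=> mn; have [n0|n0] := eqVneq n 0%N.
    by move: mn; rewrite n0 leqn0 => /eqP->; rewrite !mul0r.
  by rewrite [RHS]mulrC mulrA divfK ?pnatr_eq0.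
case: c => -[] j; rewrite /class_weight/=.
  have -> : (fun N => freq N (true, j)) = (fun N =>
      #|block (blk N) j|%:R / N%:R *
      (#|central (blk N) (ctr N) j|%:R / #|block (blk N) j|%:R)).
    apply/funext => N; rewrite /class_freq -central_size; apply: prodE.
    by apply: subset_leq_card; apply/fintype.subsetP => l; rewrite !inE => /andP[].
  exact: cvgM.
have -> : (fun N => freq N (false, j)) = (fun N =>
    #|block (blk N) j|%:R / N%:R *
    (#|peripheral (blk N) (ctr N) j|%:R / #|block (blk N) j|%:R)).
  apply/funext => N; rewrite /class_freq -peripheral_size; apply: prodE.
  by apply: subset_leq_card; apply/fintype.subsetP => l; rewrite !inE => /andP[].
exact: cvgM.
Qed.

Lemma invn_cvg0 : (N%:R : R)^-1 @[N --> \oo] --> (0 : R).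
Proof. by rewrite -cvg_shiftS; exact: cvg_harmonic. Qed.

Lemma energy_gap_cvg0 (K : nat) (W : 'I_K -> 'I_K -> R) (beta : R) :
  energy_gap W beta (node_class (blk N) (ctr N)) weight @[N --> \oo] --> (0 : R).
Proof.
rewrite /energy_gap.
have H : \sum_c `|freq N c - weight c| @[N --> \oo] --> (0 : R).
  suff : \sum_c `|freq N c - weight c| @[N --> \oo] -->
      \sum_(c : bool * 'I_r) (0 : R) by rewrite big1.
  apply: cvg_big => [|c _]; first exact: add_continuous.
  rewrite -(normr0 R) -(subrr (weight c)); apply: cvg_norm.
  by apply: cvgB; [exact: class_freq_cvg|exact: cvg_cst].
have H2 : K%:R * (\sum_c `|freq N c - weight c|) @[N --> \oo] --> K%:R * (0 : R).
  by apply: cvgM => //; exact: cvg_cst.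
have H3 : (N%:R : R)^-1 + K%:R * (\sum_c `|freq N c - weight c|)
    @[N --> \oo] --> 0 + K%:R * (0 : R).
  by apply: cvgD => //; exact: invn_cvg0.
rewrite mulr0 addr0 in H3.
have := cvgM (cvg_cst (`|beta| * (2 * W_bound W))) H3.
by rewrite mulr0; apply.
Qed.

(** The limiting weights are positive, so every class has size of order N: its inverse is 1/N times
    the inverse of a frequency with nonzero limit. *)
Lemma class_size_inv_cvg0 :
  \sum_c (class_size (node_class (blk N) (ctr N)) c)%:R^-1 @[N --> \oo] --> (0 : R).
Proof.
suff : \sum_c (class_size (node_class (blk N) (ctr N)) c)%:R^-1 @[N --> \oo] -->
    \sum_(c : bool * 'I_r) (0 : R) by rewrite big1.
apply: cvg_big => [|c _]; first exact: add_continuous.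
have w0 : weight c != 0.
  by rewrite gt_eqF// mulr_gt0//; case: ifP.
have H : (N%:R : R)^-1 * (freq N c)^-1 @[N --> \oo] --> 0 * (weight c)^-1.
  apply: cvgM; first exact: invn_cvg0.
  by apply: cvgV => //; exact: class_freq_cvg.
rewrite mul0r in H; apply: cvg_trans H; apply: near_eq_cvg; near=> N.
have N0 : (0 < N)%N by near: N; exists 1%N.
by rewrite /class_freq invfM invrK mulrC -mulrA mulfV ?mulr1// pnatr_eq0 -lt0n.
Unshelve. all: by end_near. Qed.

End ClassFrequencies.

(** Weak convergence only tests bounded functions, and the squared distance to [nu] is unbounded on
    the space of matrix pairs. It is truncated at the number of coordinates, a level that it never
    exceeds at an empirical vector, whose entries lie in [0, 1] like those of [nu]. *)
Lemma initial_sqdist_cvg0 (R : realType) (K r : nat)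
    (blk : forall N, 'I_N -> 'I_r) (ctr : forall N, 'I_N -> bool)
    (d : nat -> measure_display) (Omega : forall N, measurableType (d N))
    (P : forall N, probability (Omega N) R)
    (Y : forall N, Omega N -> {ffun 'I_N -> 'I_K}) (nu : measure_vector R r K) :
  (forall N s, measurable [set w | Y N w = s]) ->
  probability_vectors nu ->
  converges_weakly_to P
    (fun N w => empirical_vector R (blk N) (ctr N) (Y N w)) nu ->
  \sum_x fine (P N [set w | Y N w = x]) *
    (\sum_i (emp R (node_class (blk N) (ctr N)) x i - coord nu i) ^+ 2)
    @[N --> \oo] --> (0 : R).
Proof.
move=> Y_meas /probability_vectorsP/simplexes_cube nu01 Y_nu.
pose n : R := #|{: (bool * 'I_r) * 'I_K}|%:R.
pose g (q : measure_vector R r K) : R := \sum_i (coord q i - coord nu i) ^+ 2.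
have g0 q : 0 <= g q by apply: sumr_ge0 => i _; exact: sqr_ge0.
have g_cont : continuous g.
  move=> q; apply: cvg_big => [|i _]; first exact: add_continuous.
  have cB : coord u i - coord nu i @[u --> q] --> coord q i - coord nu i.
    by apply: cvgB; [exact: coord_cont|exact: cvg_cst].
  exact: (cvgM cB cB).
pose f q := Num.min (g q) n.
have f_cont : continuous f.
  by move=> q; apply: continuous_min; [exact: g_cont|exact: cvg_cst].
have f0 q : 0 <= f q by rewrite le_min g0 /n ler0n.
have f_bnd : [bounded f q | q in setT].
  exists n; split => [|M nM q _ /=]; first exact: num_real.
  by rewrite ger0_norm// (le_trans _ (ltW nM))// ge_min lexx orbT.
have := Y_nu f f_cont f_bnd.
have -> : f nu = 0.
  by rewrite /f /g big1 => [|i _]; rewrite ?subrr ?expr0n// min_l// ler0n.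
under eq_fun => N.
  have -> := expectation_finite_valued (P N) (Y_meas N)
    (g := fun x => f (empirical_vector R (blk N) (ctr N) x)) (fun x => f0 _).
  over.
move=> /fine_cvgP[_]; apply: cvg_trans; apply: near_eq_cvg; apply: nearW => N /=.
apply: eq_bigr => x _; rewrite mulrC; congr (_ * _).
have -> : \sum_i (emp R (node_class (blk N) (ctr N)) x i - coord nu i) ^+ 2 =
    g (empirical_vector R (blk N) (ctr N) x).
  by apply: eq_bigr => i _; rewrite coord_empirical_vector.
rewrite /f min_l// /n -sumr_const /g; apply: ler_sum => i _.
rewrite coord_empirical_vector.
have /andP[? ?] := emp_cube R (node_class (blk N) (ctr N)) x i.
have /andP[? ?] := nu01 i.
rewrite -[leRHS](expr1n _ 2) -(real_normK (num_real _)).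
by rewrite ler_pXn2r ?nnegrE// ler_norml; apply/andP; split; lra.
Qed.

Theorem proposition2p1 (R : realType) (K r : nat)
  (* limiting proportions *)
  (alpha pc pp : 'I_r -> R)
  (alpha01 : forall j, 0 < alpha j < 1)
  (pc01 : forall j, 0 < pc j < 1)
  (pp01 : forall j, 0 < pp j < 1)
  (pcpp : forall j, pc j + pp j = 1)
  (sum_alpha : \sum_(j < r) alpha j = 1)
  (* block structure of the N nodes *)
  (blk : forall N, 'I_N -> 'I_r) (ctr : forall N, 'I_N -> bool)
  (block_lim : forall j,
    #|block (blk N) j|%:R / N%:R @[N --> \oo] --> alpha j)
  (central_lim : forall j,
    #|central (blk N) (ctr N) j|%:R / #|block (blk N) j|%:R @[N --> \oo]
      --> pc j)
  (peripheral_lim : forall j,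
    #|peripheral (blk N) (ctr N) j|%:R / #|block (blk N) j|%:R @[N --> \oo]
      --> pp j)
  (* interaction and admissible jumps *)
  (W : 'I_K -> 'I_K -> R) (W_sym : forall z z', W z z' = W z' z)
  (beta : R) (beta_gt0 : 0 < beta)
  (E : rel 'I_K) (E_irr : irreflexive E) (E_sym : symmetric E)
  (E_connected : forall z z', connect E z z')
  (* particle systems *)
  (d : nat -> measure_display) (Omega : forall N, measurableType (d N))
  (P : forall N, probability (Omega N) R)
  (X : forall N, R -> Omega N -> {ffun 'I_N -> 'I_K})
  (X_markov : forall N,
    markov_chain (P N) (jump_rate W beta E (blk N) (ctr N)) (X N))
  (X_exch : forall N, multi_exchangeable (P N) (blk N) (ctr N) (X N 0))
  (* initial condition *)
  (nu : measure_vector R r K) (nu_prob : probability_vectors nu)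
  (init_lim : converges_weakly_to P
    (fun N w => empirical_vector R (blk N) (ctr N) (X N 0 w)) nu) :
  exists mu : R -> measure_vector R r K,
    [/\ mckean_vlasov W beta E alpha pc pp nu mu,
        forall mu', mckean_vlasov W beta E alpha pc pp nu mu' ->
          forall t, 0 <= t -> mu' t = mu t &
        forall T eps : R, 0 < T -> 0 < eps ->
          P N [set w | (eps%:E < ereal_sup
                 [set (`|empirical_vector R (blk N) (ctr N) (X N t w)
                         - mu t|)%:E | t in `[0%R, T]])%E]
            @[N --> \oo] --> 0%E].
Proof.
have sol := limit_solution_mckean_vlasov alpha pc pp W beta E_irr nu_prob.
exists (limit_solution alpha pc pp W beta E nu); split => //.
  by move=> mu' sol'; exact: (mckean_vlasov_unique E_irr sol sol').
move=> T eps T0 eps0.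
pose w_ := class_weight alpha pc pp.
pose L := drift_lip W beta w_.
pose m := limit_path alpha pc pp W beta E nu.
pose mu := limit_solution alpha pc pp W beta E nu.
pose cls N := node_class (blk N) (ctr N).
pose n : R := #|{: (bool * 'I_r) * 'I_K}|%:R.
pose d1 N : R := K%:R * energy_gap W beta (cls N) w_.
pose d2 N : R := K%:R * \sum_c (class_size (cls N) c)%:R^-1.
pose delta N := n * (2 * d1 N + d2 N).
(* The factor of the probability in [sup_sqdist_bound] for the threshold eps^2. *)
pose c := eps ^+ 2 * expR (- (2 * L * n * T)).
pose E0 N := \sum_x fine (P N [set w | X N 0 w = x]) *
    (\sum_i (emp R (cls N) x i - coord nu i) ^+ 2).
have c0 : 0 < c by rewrite mulr_gt0 ?expR_gt0// exprn_gt0.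
have [M M0 quad] := limit_path_quadratic alpha pc pp W beta E nu_prob.
have m01 t i : 0 <= t -> 0 <= m t i <= 1.
  by move=> t0; apply: simplexes_cube; exact: limit_path_in.
pose far N t (x : {ffun 'I_N -> 'I_K}) :=
  eps < `|empirical_vector R (blk N) (ctr N) x - mu t|.
(* With a strict inequality, a supremum exceeds [eps] exactly when some value does, so the event
   needs no attained supremum. *)
have eventE N : [set w | (eps%:E < ereal_sup
      [set (`|empirical_vector R (blk N) (ctr N) (X N t w) - mu t|)%:E
        | t in `[0%R, T]])%E] = some_time (X N) T (far N).
  apply/seteqP; split => [w /ereal_sup_gtP[_ [t /= tT <-]]|w [t tT bt]].
    by rewrite lte_fin => bt; exists t => //; rewrite in_itv in tT.
  apply/ereal_sup_gtP.
  exists (`|empirical_vector R (blk N) (ctr N) (X N t w) - mu t|)%:E.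
    by exists t => //=; rewrite in_itv.
  by rewrite lte_fin.
have mu_cont : continuous mu by exact: limit_solution_continuous.
have far_right N t x : 0 <= t -> far N t x -> \forall u \near t^'+, far N u x.
  move=> t0 tx.
  have fc : `|empirical_vector R (blk N) (ctr N) x - mu u| @[u --> t^'+] -->
      `|empirical_vector R (blk N) (ctr N) x - mu t|.
    apply: cvg_norm; apply: cvgB; first exact: cvg_cst.
    apply: cvg_at_right_filter.
    exact: mu_cont.
  exact: (cvgr_gt _ fc).
have far_meas N : measurable (some_time (X N) T (far N)).
  have [X_meas X_right _] := X_markov N.
  by apply: some_time_measurable => //; exact: far_right.
have bound N : 0 <= fine (P N (some_time (X N) T (far N))) <=
    (E0 N + delta N * T) / c.
  have [X_meas X_right [p [p_trans p_rate X_fdd]]] := X_markov N.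
  have jE : jump_rate W beta E (blk N) (ctr N) =
      metropolis_rate (@class_adj r) W beta E (cls N).
    by apply/funext => x; apply/funext => y; exact: jump_rateE.
  rewrite jE in p_rate.
  rewrite fine_ge0//= ler_pdivlMr//.
  have delta0 : 0 <= delta N.
    have d1_ge0 : 0 <= d1 N by apply: mulr_ge0 => //; exact: energy_gap_ge0.
    have d2_ge0 : 0 <= d2 N.
      by apply: mulr_ge0 => //; apply: sumr_ge0 => k _; rewrite invr_ge0.
    by apply: mulr_ge0 => //; apply: addr_ge0 => //; exact: mulr_ge0.
  have sup_bound := sup_sqdist_bound (emp_cube R (cls N))
    (drift_lip_ge0 W beta w_)
    (@mf_drift_lipschitz R K _ (@class_adj r) W beta E w_)
    (@mf_drift_bounded R K _ (@class_adj r) W beta E w_)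
    (metropolis_drift beta (cls N) (@class_adj_sym r) W_sym E_irr w_)
    (metropolis_quadratic (@class_adj r) W beta (cls N) E_irr)
    m01 quad p_trans p_rate (ler0n R K) X_meas X_right X_fdd T0
    (exprn_gt0 2 eps0) delta0.
  rewrite mulrC -[E0 N](_ : \sum_x fine (P N [set w | X N 0 w = x]) *
      sqdist (emp R (cls N)) m 0 x = E0 N); last first.
    apply: eq_bigr => x _; congr (_ * _); apply: eq_bigr => i _.
    by rewrite /m /limit_path flow0.
  apply: le_trans sup_bound; rewrite -/c ler_pM2l//.
  have near_meas : measurable (some_time (X N) T
      (fun t x => eps ^+ 2 < sqdist (emp R (cls N)) m t x)).
    apply: some_time_measurable => // t x t0 tx.
    have sq_cvg := sqdist_cvg_right (q := emp R (cls N))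
      (@mf_drift_bounded R K _ (@class_adj r) W beta E w_) m01 quad (ler0n R K)
      (x := x) t0.
    exact: (cvgr_gt _ sq_cvg).
  rewrite fine_le ?fin_num_measure// le_measure ?inE//.
  (* The norm is the maximum of the coordinates, each of whose squares is at most the sum of
     squares; a distance above [eps] thus forces a squared distance above eps^2. *)
  move=> w [t tT]; rewrite /far => far_t; exists t => //.
  have t0 : 0 <= t by case/andP: tT.
  move: far_t; rewrite ltNge => /negP far_t.
  rewrite ltNge; apply/negP => near_t; apply: far_t.
  apply/(mv_norm_le _ (ltW eps0)) => i.
  rewrite coordB coord_empirical_vector of_coordK (max_idPl t0).
  rewrite -ler_sqr ?nnegrE ?(ltW eps0)// real_normK ?num_real//.
  apply: le_trans near_t.
  apply: (@term_le_sum _ _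
    (fun i => (emp R (cls N) (X N t w) i - m t i) ^+ 2)) => k.
  exact: sqr_ge0.
under eq_fun do rewrite eventE.
apply: cvg_EFin.
  by apply: nearW => N; rewrite fin_num_measure//; exact: far_meas.
apply: (squeeze_cvgr (f := cst 0) (h := fun N => (E0 N + delta N * T) / c)).
- by apply: nearW => N; exact: bound.
- exact: cvg_cst.
- have E0_cvg : E0 N @[N --> \oo] --> (0 : R).
    apply: initial_sqdist_cvg0 nu_prob init_lim => N s.
    by have [X_meas _ _] := X_markov N; exact: X_meas.
  have d1_cvg : d1 N @[N --> \oo] --> K%:R * (0 : R).
    by apply: cvgM; [exact: cvg_cst|exact: energy_gap_cvg0].
  have d2_cvg : d2 N @[N --> \oo] --> K%:R * (0 : R).
    apply: cvgM; first exact: cvg_cst.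
    apply: class_size_inv_cvg0 block_lim central_lim peripheral_lim => j.
    + by have /andP[] := alpha01 j.
    + by have /andP[] := pc01 j.
    + by have /andP[] := pp01 j.
  rewrite mulr0 in d1_cvg d2_cvg.
  have d_cvg : 2 * d1 N + d2 N @[N --> \oo] --> 2 * 0 + (0 : R).
    by apply: cvgD => //; apply: cvgM => //; exact: cvg_cst.
  have delta_cvg : delta N * T @[N --> \oo] --> n * (2 * 0 + (0 : R)) * T.
    by apply: cvgM; [apply: cvgM => //; exact: cvg_cst|exact: cvg_cst].
  have -> : (0 : R) = (0 + n * (2 * 0 + 0) * T) / c.
    by rewrite mulr0 addr0 mulr0 mul0r addr0 mul0r.
  by apply: cvgM; [exact: cvgD|exact: cvg_cst].
Qed.
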